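(* The Rees ring $\mathcal{R}(I)$ of a rational normal scroll is a Koszul algebra.
   Context: Let $\mathbb{K}$ be an arbitrary field, $n_1,\ldots,n_d$ positive integers, $c=\sum_i n_i$, and $R=\mathbb{K}[x_{i,j}\mid 1\le i\le d,\ 0\le j\le n_i]$. The rational normal scroll $\mathcal{S}_{n_1,\ldots,n_d}\subseteq\mathbb{P}^{c+d-1}$ is the projective variety whose homogeneous ideal $I\subseteq R$ is generated by the $2\times2$ minors of the $2\times c$ matrix obtained by juxtaposing, for $i=1,\ldots,d$, the blocks $$\begin{pmatrix}x_{i,0}&x_{i,1}&\cdots&x_{i,n_i-1}\\ x_{i,1}&x_{i,2}&\cdots&x_{i,n_i}\end{pmatrix}.$$ Its Rees ring is $\mathcal{R}(I)=R[It]\subseteq R[t]$, bigraded by $\deg x_{i,j}=(1,0)$ and $\deg t=(-2,1)$, so that it is generated over $\mathbb{K}$ in bidegrees $(1,0)$ and $(0,1)$; with the total grading it is a standard graded $\mathbb{K}$-algebra. A standard graded $\mathbb{K}$-algebra $A$ is Koszul if $\mathrm{Tor}_i^A(\mathbb{K},\mathbb{K})_j=0$ whenever $i\ne j$. *)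

(* Defs.v *)
From HB Require Import structures.
From mathcomp Require Import all_boot all_algebra.
From mathcomp Require Import boolp.
From mathcomp Require Import mpoly freeg.

Set Implicit Arguments.
Unset Strict Implicit.
Unset Printing Implicit Defensive.

Import GRing.Theory.
Local Open Scope ring_scope.

(* -------------------------------------------------------------------- *)
(** * Standard graded algebras and the Koszul property                   *)

Section Koszul.
Variables (K : fieldType) (A : comAlgType K).

(** [gr n] is the homogeneous component of degree [n]. *)
Variable gr : nat -> A -> Prop.

Record standard_graded : Prop := StandardGraded {
  gr_0 : forall n, gr n 0;
  gr_lin : forall n (c : K) a b, gr n a -> gr n b -> gr n (c *: a + b);
  gr_mul : forall m n a b, gr m a -> gr n b -> gr (m + n) (a * b);
  gr_span : forall a, exists n (f : nat -> A),
    (forall i, gr i (f i)) /\ a = \sum_(i < n) f i;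
  gr_direct : forall n (f : nat -> A), (forall i, gr i (f i)) ->
    \sum_(i < n) f i = 0 -> forall i, (i < n)%N -> f i = 0;
  gr_deg0 : forall a, gr 0 a <-> exists c : K, a = c%:A;
  gr_deg1 : exists s : seq A, (forall a, a \in s -> gr 1 a) /\
    forall a, gr 1 a -> exists c : A -> K, a = \sum_(x <- s) c x *: x;
  gr_gen : forall n a, gr n.+1 a -> exists s : seq (A * A),
    (forall p, p \in s -> gr 1 p.1 /\ gr n p.2) /\
    a = \sum_(p <- s) p.1 * p.2
}.

(** The irrelevant ideal [A_+], the sum of the components of positive degree,
    so that the [A]-module [K] is [A / A_+]. *)
Definition irrelevant (a : A) : Prop := exists s : seq A,
  (forall x, x \in s -> exists n, gr n.+1 x) /\ a = \sum_(x <- s) x.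

(** The free module on [B], the basis element [b] having degree [deg b], is
    the direct sum of the [A(- deg b)]; degrees in [int], since a graded free
    module may have generators of negative degree. *)
Definition fhomog (B : choiceType) (deg : B -> int) (j : int)
    (z : {freeg B / A}) : Prop :=
  forall b, coeff b z = 0 \/ exists2 e : nat, j = deg b + e%:Z & gr e (coeff b z).

(** [A_+ F]. *)
Definition firrelevant (B : choiceType) (z : {freeg B / A}) : Prop :=
  forall b, irrelevant (coeff b z).

(** Graded free resolutions [... -> F_1 -> F_0 -> K -> 0] of the graded
    [A]-module [K], concentrated in degree 0. The maps preserve degrees, and
    linearity of [res_aug] over [A] means that it is linear over [K] and
    vanishes on [A_+ F_0]. *)
Record resolution := Resolution {
  res_gen : nat -> choiceType;
  res_deg : forall i, res_gen i -> int;
  res_diff : forall i,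
    {linear {freeg (res_gen i.+1) / A} -> {freeg (res_gen i) / A}};
  res_aug : {additive {freeg (res_gen 0) / A} -> K};
  _ : forall i j z, fhomog (@res_deg i.+1) j z ->
        fhomog (@res_deg i) j (res_diff i z);
  _ : forall (c : K) z, res_aug (c%:A *: z) = c * res_aug z;
  _ : forall a z, irrelevant a -> res_aug (a *: z) = 0;
  _ : forall j z, j != 0 -> fhomog (@res_deg 0) j z -> res_aug z = 0;
  _ : forall c, exists z, res_aug z = c;
  _ : forall z, res_aug z = 0 <-> exists y, z = res_diff 0 y;
  _ : forall i z, res_diff i z = 0 <-> exists y, z = res_diff i.+1 y
}.

(** The cycles of [K (x)_A F = F / A_+ F], as a condition on representatives
    in [F_i]. *)
Definition tor_cycle (F : resolution) (i : nat) :
    {freeg (res_gen F i) / A} -> Prop :=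
  match i with
  | 0 => fun=> True
  | k.+1 => fun z => firrelevant (res_diff F k z)
  end.

(** The component of degree [j] of [H_i (K (x)_A F)] is zero. *)
Definition homology_vanishes (F : resolution) (i : nat) (j : int) : Prop :=
  forall z, fhomog (@res_deg F i) j z -> tor_cycle z ->
  exists2 y, fhomog (@res_deg F i.+1) j y & firrelevant (z - res_diff F i y).

(** [Tor_i^A(K, K)_j = 0]. Tor does not depend on the resolution, and
    resolutions exist by [resolution_exists] below. *)
Definition Tor_vanishes (i : nat) (j : int) : Prop :=
  forall F : resolution, homology_vanishes F i j.

Definition Koszul : Prop :=
  standard_graded /\ forall (i : nat) (j : int), i%:Z != j -> Tor_vanishes i j.

End Koszul.

(* -------------------------------------------------------------------- *)
(** * Existence of graded free resolutions

    [F_0 = A], and [F_(i+1)] has one generator for each homogeneous element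
    of the kernel of [F_i -> F_(i-1)]. *)

Section ResolutionExists.
Variables (K : fieldType) (A : comAlgType K) (gr : nat -> A -> Prop).
Hypothesis grA : standard_graded gr.

Let grD n a b : gr n a -> gr n b -> gr n (a + b).
Proof. by move=> ha hb; rewrite -[a]scale1r; apply: (gr_lin grA). Qed.

Let gr_sum n (I : eqType) (s : seq I) (P : pred I) (f : I -> A) :
  (forall i, i \in s -> P i -> gr n (f i)) -> gr n (\sum_(i <- s | P i) f i).
Proof.
move=> h; rewrite big_seq_cond; elim/big_rec: _ => [|i x /andP[si Pi] hx].
  exact: (gr_0 grA).
by apply: grD => //; apply: h.
Qed.

Fact irrelevantD a b :
  irrelevant gr a -> irrelevant gr b -> irrelevant gr (a + b).
Proof.
move=> [s [hs ->]] [t [ht ->]]; exists (s ++ t); rewrite big_cat; split=> // x.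
by rewrite mem_cat => /orP[]; [apply: hs | apply: ht].
Qed.

Fact irrelevant_sum (I : Type) (s : seq I) (f : I -> A) :
  (forall i, irrelevant gr (f i)) -> irrelevant gr (\sum_(i <- s) f i).
Proof.
move=> h; elim/big_rec: _ => [|i x _ hx]; last exact: irrelevantD.
by exists [::]; rewrite big_nil.
Qed.

Fact irrelevantM a b : irrelevant gr b -> irrelevant gr (a * b).
Proof.
move=> [s [hs ->]]; have [n [f [hf ->]]] := gr_span grA a.
rewrite mulr_suml; apply: irrelevant_sum => i.
exists [seq f i * x | x <- s]; rewrite big_map mulr_sumr; split=> // y.
case/mapP=> x /hs[k hk] ->; exists (i + k)%N; rewrite -addnS.
exact: (gr_mul grA).
Qed.

Fact irrelevant_nat a : irrelevant gr a -> exists n (f : nat -> A),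
  (forall i, gr i.+1 (f i)) /\ a = \sum_(i < n) f i.
Proof.
move=> [s [+ ->]]; elim: s => [|x s IHs] hs.
  exists 0%N, (fun=> 0); rewrite big_nil big_ord0.
  by split=> // i; apply: (gr_0 grA).
have [y ys|n [f [hf e]]] := IHs; first by apply: hs; rewrite inE ys orbT.
have [k hk] := hs x (mem_head _ _).
exists (n + k.+1)%N,
  (fun i => (if (i < n)%N then f i else 0) + (if i == k then x else 0)).
split=> [i|].
  apply: grD; first by case: ifP => // _; apply: (gr_0 grA).
  by case: eqP => [-> //|_]; apply: (gr_0 grA).
rewrite big_cons e big_split /= [LHS]addrC; congr (_ + _).
  by rewrite (big_ord_widen _ f (leq_addr k.+1 n)) big_mkcond.
by rewrite -big_mkcond /= (big_pred1 (Ordinal (leq_addl n k.+1))).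
Qed.

Fact irrelevant_cst (c : K) : irrelevant gr c%:A -> c = 0.
Proof.
case/irrelevant_nat => n [f [hf e]].
pose g i := if i is i'.+1 then f i' else - c%:A.
have hg i : gr i (g i).
  by case: i => [|i] //=; apply/(gr_deg0 grA); exists (- c); rewrite scaleNr.
have /(gr_direct grA hg)/(_ 0%N isT)/eqP : \sum_(i < n.+1) g i = 0.
  by rewrite big_ord_recl /= -e addNr.
by rewrite /= oppr_eq0 => /eqP h; apply/eqP; apply/negPn/negP => c0;
  have /eqP := congr1 ( *:%R c^-1) h; rewrite scalerA mulVf // scale1r scaler0 oner_eq0.
Qed.

Fact irrelevant_split a : exists c : K, irrelevant gr (a - c%:A).
Proof.
have [[|n] [f [hf ->]]] := gr_span grA a.
  by exists 0; rewrite big_ord0 scale0r subr0; exists [::]; rewrite big_nil.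
have /(gr_deg0 grA)[c ec] := hf 0%N; exists c.
rewrite big_ord_recl ec addrAC subrr add0r; apply: irrelevant_sum => i.
by exists [:: f (bump 0 i)]; rewrite big_seq1; split=> // x; rewrite inE => /eqP->;
  exists i; apply: hf.
Qed.

Definition residue a : K := projT1 (cid (irrelevant_split a)).

Fact residueP a c : irrelevant gr (a - c%:A) -> residue a = c.
Proof.
rewrite /residue; case: cid => b /= hb hc; apply/eqP; rewrite -subr_eq0.
apply/eqP/irrelevant_cst; rewrite scalerBl.
have -> : b%:A - c%:A = (a - c%:A) + (-1) * (a - b%:A).
  by rewrite mulN1r opprB [RHS]addrC addrA addrNK.
by apply: irrelevantD => //; apply: irrelevantM.
Qed.

Fact residue_irr a : irrelevant gr (a - (residue a)%:A).
Proof. by rewrite /residue; case: cid. Qed.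

Fact residueD a b : residue (a + b) = residue a + residue b.
Proof.
apply: residueP; rewrite scalerDl opprD addrACA.
by apply: irrelevantD; apply: residue_irr.
Qed.

Fact residueM a b : residue (a * b) = residue a * residue b.
Proof.
apply: residueP; have -> : a * b - (residue a * residue b)%:A =
   b * (a - (residue a)%:A) + (residue a)%:A * (b - (residue b)%:A).
  rewrite !mulrBr [b * a]mulrC [b * _]mulrC addrA addrNK.
  by rewrite -scalerAl mul1r scalerA.
by apply: irrelevantD; apply/irrelevantM/residue_irr.
Qed.

Fact residue_eq0 a : residue a = 0 <-> irrelevant gr a.
Proof.
split=> [ha|ha]; first by have := residue_irr a; rewrite ha scale0r subr0.
by apply: residueP; rewrite scale0r subr0.
Qed.

Fact residue_cst c : residue c%:A = c.
Proof. by apply: residueP; rewrite subrr; exists [::]; rewrite big_nil. Qed.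

Section Free.
Variables (B : choiceType) (deg : B -> int).
Local Notation F := {freeg B / A}.
Local Notation hom := (fhomog gr deg).

Fact fhomog0 j : hom j 0.
Proof. by move=> b; rewrite coeff0; left. Qed.

Fact fhomogD j z w : hom j z -> hom j w -> hom j (z + w).
Proof.
move=> hz hw b; rewrite coeffD.
case: (hz b) => [->|[e je ge]]; first by rewrite add0r; apply: hw.
case: (hw b) => [->|[e' je' ge']]; first by rewrite addr0; right; exists e.
right; exists e => //; apply: grD => //; suff -> : e = e' by [].
by move: je; rewrite je' => /addrI[].
Qed.

Fact fhomog_sum j (I : eqType) (s : seq I) (P : pred I) (f : I -> F) :
  (forall i, i \in s -> P i -> hom j (f i)) -> hom j (\sum_(i <- s | P i) f i).
Proof.
move=> h; rewrite big_seq_cond; elim/big_rec: _ => [|i x /andP[si Pi] hx].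
  exact: fhomog0.
by apply: fhomogD => //; apply: h.
Qed.

Fact fhomogU a e b : gr e a -> hom (deg b + e%:Z) << a *g b >>.
Proof.
move=> ga b'; rewrite coeffU; case: eqP => [<-|_]; last by rewrite mulr0; left.
by rewrite mulr1; right; exists e.
Qed.

Fact fhomogZ a e j z : gr e a -> hom j z -> hom (j + e%:Z) (a *: z).
Proof.
move=> ga hz b; rewrite coeffZ; case: (hz b) => [->|[e' -> gz]].
  by rewrite mulr0; left.
by right; exists (e' + e)%N; rewrite ?PoszD ?addrA // addnC; apply: (gr_mul grA).
Qed.

Fact fhomog_span z : exists s : seq (int * F),
  (forall p, p \in s -> hom p.1 p.2) /\ z = \sum_(p <- s) p.2.
Proof.
rewrite -[z]freeg_sumE; elim: (dom z) => [|b t [s [hs es]]].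
  by exists [::]; rewrite !big_nil.
have [n [f [hf ef]]] := gr_span grA (coeff b z).
exists ([seq (deg b + (i : nat)%:Z, << f i *g b >>) | i : 'I_n] ++ s); split.
  move=> p; rewrite mem_cat => /orP[/mapP[i _ ->]|/hs //] /=.
  exact: fhomogU.
rewrite big_cons big_cat es; congr (_ + _); rewrite big_map /= enumT ef.
apply/eqP/freeg_eqP => b'; rewrite coeffU mulr_suml raddf_sum /=.
by apply: eq_bigr => i _; rewrite coeffU.
Qed.

Fact fhomog_direct (js : seq int) (w : int -> F) : uniq js ->
  (forall j, hom j (w j)) -> \sum_(j <- js) w j = 0 ->
  forall j, j \in js -> w j = 0.
Proof.
move=> ujs hw w0 j jjs; apply/eqP/freeg_eqP => b; rewrite coeff0.
case: (hw j b) => // -[e je _].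
pose f e := \sum_(j <- js | j == deg b + e%:Z) coeff b (w j).
have hf i : gr i (f i).
  apply: gr_sum => k _ /eqP ->; case: (hw (deg b + i%:Z) b) => [->|].
    exact: (gr_0 grA).
  by case=> e' /addrI[<-].
have fe i : i%:Z + deg b \in js -> f i = coeff b (w (i%:Z + deg b)).
  move=> ijs; rewrite /f (eq_bigl (pred1 (i%:Z + deg b))) => [|k] /=.
    by rewrite -big_filter filter_pred1_uniq ?big_seq1.
  by rewrite addrC.
pose n := (\max_(j <- js) absz (j - deg b)%R).+1.
have : \sum_(i < n) f i = 0.
  have := congr1 (coeff b) w0; rewrite coeff0 raddf_sum /= => w0b; rewrite -[RHS]w0b.
  rewrite /f (exchange_big_dep xpredT) //= big_seq [RHS]big_seq.
  apply: eq_bigr => k kjs; case: (hw k b) => [->|[i ki _]].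
    by rewrite big1.
  have ltin : (i < n)%N.
    rewrite ltnS; apply: leq_trans (leq_bigmax_seq _ kjs isT).
    by rewrite ki addrAC subrr add0r.
  rewrite (big_pred1 (Ordinal ltin)) // => i' /=.
  by rewrite ki (inj_eq (addrI _)) eq_sym.
move=> /(gr_direct grA hf)/(_ e); rewrite fe addrC -je // => -> //.
rewrite ltnS; apply: leq_trans (leq_bigmax_seq _ jjs isT).
by rewrite je addrAC subrr add0r.
Qed.

Record graded_submod (Z : F -> Prop) : Prop := GradedSubmod {
  gs_lin : forall a z w, Z z -> Z w -> Z (a *: z + w);
  gs_0 : Z 0;
  gs_span : forall z, Z z -> exists s : seq (int * F),
    (forall p, p \in s -> hom p.1 p.2 /\ Z p.2) /\ z = \sum_(p <- s) p.2
}.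

Variables (Z : F -> Prop) (ZP : graded_submod Z).

Definition cover_gen : choiceType :=
  {p : int * F | `[< hom p.1 p.2 /\ Z p.2 >]}.
Definition cover_deg (b : cover_gen) : int := (val b).1.
Definition cover_fun (z : {freeg cover_gen / A}) : F :=
  fglift (fun b : cover_gen => (val b).2) z.

Fact cover_additive : additive cover_fun.
Proof. exact: lift_is_additive. Qed.
HB.instance Definition _ := GRing.isAdditive.Build _ _ cover_fun cover_additive.

Fact coverE z : cover_fun z = \sum_(b <- dom z) coeff b z *: (val b).2.
Proof.
rewrite -{1}[z]freeg_sumE raddf_sum /=; apply: eq_bigr => b _.
by rewrite /cover_fun liftU.
Qed.

Fact cover_scalable : scalable cover_fun.
Proof.
move=> a z; rewrite -[z]freeg_sumE scaler_sumr (raddf_sum cover_fun).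
rewrite [X in _ *: X](raddf_sum cover_fun) scaler_sumr /=.
apply: eq_bigr => b _; rewrite /cover_fun.
have -> : a *: << coeff b z *g b >> = << a * coeff b z *g b >> :> {freeg cover_gen / A}.
  by apply/eqP/freeg_eqP => b'; rewrite coeffZ !coeffU mulrA.
by rewrite !liftU scalerA.
Qed.
HB.instance Definition _ :=
  GRing.isScalable.Build A _ _ *:%R cover_fun cover_scalable.

Fact cover_hom j z : fhomog gr cover_deg j z -> hom j (cover_fun z).
Proof.
move=> hz; rewrite coverE; apply: fhomog_sum => b _ _.
case: (hz b) => [->|[e -> ge]]; first by rewrite scale0r; apply: fhomog0.
by apply: fhomogZ => //; case: (asboolP _ (valP b)).
Qed.

Fact cover_im z : Z z <-> exists y, z = cover_fun y.
Proof.
split=> [/(gs_span ZP)[s [hs ->]]|[y ->]].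
  elim: s hs => [|p s IHs] hs; first by exists 0; rewrite big_nil raddf0.
  have [q qs|y ey] := IHs; first by apply: hs; rewrite inE qs orbT.
  have hp : `[< hom p.1 p.2 /\ Z p.2 >] by apply/asboolP/hs/mem_head.
  exists (<< (exist _ p hp : cover_gen) >> + y).
  by rewrite big_cons raddfD /= -ey; congr (_ + _); rewrite /cover_fun liftU scale1r.
rewrite coverE; elim/big_rec: _ => [|b x _ hx]; first exact: gs_0.
by apply: gs_lin => //; case: (asboolP _ (valP b)).
Qed.

End Free.

Fact cover_ker (B : choiceType) (deg : B -> int) (Z : {freeg B / A} -> Prop) :
  graded_submod (cover_deg (deg := deg) (Z := Z)) (fun z => cover_fun z = 0).
Proof.
split=> [a z w hz hw||z hz]; first by rewrite linearP /= hz hw scaler0 addr0.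
  exact: raddf0.
have [s [hs ez]] := fhomog_span (@cover_deg _ deg Z) z.
pose w j := \sum_(p <- s | p.1 == j) p.2.
have hw j : fhomog gr (@cover_deg _ deg Z) j (w j).
  by apply: fhomog_sum => p /hs hp /eqP <-.
pose js := undup [seq p.1 | p <- s].
have ew : z = \sum_(j <- js) w j.
  rewrite ez /w (exchange_big_dep xpredT) //= big_seq [RHS]big_seq.
  apply: eq_bigr => p ps; rewrite (eq_bigl (pred1 p.1)) => [|j]; last first.
    by rewrite /= eq_sym.
  by rewrite -big_filter filter_pred1_uniq ?big_seq1 ?undup_uniq // mem_undup map_f.
exists [seq (j, w j) | j <- js]; rewrite big_map; split=> // p /mapP[j jjs ->] /=.
split=> //; have hc i : fhomog gr deg i (cover_fun (w i)) by apply: cover_hom.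
apply: (fhomog_direct (undup_uniq _) hc _ jjs).
by rewrite -(raddf_sum (@cover_fun B deg Z)) -ew.
Qed.

Record stage := Stage {
  st_gen : choiceType;
  st_deg : st_gen -> int;
  st_Z : {freeg st_gen / A} -> Prop;
  st_P : graded_submod st_deg st_Z
}.

Definition stage0_Z (z : {freeg unit / A}) := irrelevant gr (coeff tt z).

Fact stage0_P : graded_submod (fun=> 0) stage0_Z.
Proof.
rewrite /stage0_Z; split=> [a z w hz hw||z [s [hs ez]]].
- by rewrite coeffD coeffZ; apply: irrelevantD => //; apply: irrelevantM.
- by rewrite coeff0; exists [::]; rewrite big_nil.
pose e (x : A) := if pselect (exists n, gr n.+1 x) is left h
  then (projT1 (cid h)).+1 else 0%N.
exists [seq ((e x)%:Z, << x *g tt >>) | x <- s]; split; last first.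
  apply/eqP/freeg_eqP => -[]; rewrite ez big_map raddf_sum /=.
  by apply: eq_bigr => x _; rewrite coeffU mulr1.
move=> p /mapP[x xs ->] /=; split.
  have ge : gr (e x) x.
    by rewrite /e; case: pselect (hs _ xs) => // h _; case: cid.
  by have := fhomogU (fun=> 0) tt ge; rewrite add0r.
rewrite coeffU mulr1; exists [:: x]; rewrite big_seq1; split=> // y.
by rewrite inE => /eqP ->; apply: hs.
Qed.

Definition next_stage (S : stage) : stage :=
  Stage (@cover_ker (st_gen S) (@st_deg S) (@st_Z S)).

Definition stages k : stage := iter k next_stage (Stage stage0_P).

Definition stage0_aug (z : {freeg unit / A}) : K := residue (coeff tt z).

Fact stage0_aug_additive : additive stage0_aug.
Proof.
move=> z w; rewrite /stage0_aug raddfB /= residueD; congr (_ + _).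
by rewrite -mulN1r residueM -scaleN1r residue_cst mulN1r.
Qed.
HB.instance Definition _ :=
  GRing.isAdditive.Build _ _ stage0_aug stage0_aug_additive.

Theorem resolution_exists : inhabited (resolution gr).
Proof.
unshelve apply: inhabits (@Resolution K A gr (fun k => st_gen (stages k))
  (fun k => @st_deg (stages k))
  (fun k => @cover_fun _ (@st_deg (stages k)) (@st_Z (stages k)))
  (stage0_aug : {additive _ -> K}) _ _ _ _ _ _ _) => //=.
- by move=> k j z; apply: cover_hom.
- by move=> c z; rewrite /stage0_aug coeffZ residueM residue_cst.
- move=> a z /residue_eq0 ha.
  by rewrite /stage0_aug coeffZ residueM ha mul0r.
- move=> j z j0 /(_ tt) hz; rewrite /stage0_aug; apply/residue_eq0.
  case: hz => [->|[[|e]]]; first by exists [::]; rewrite big_nil.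
    by move=> ej; rewrite ej addr0 eqxx in j0.
  move=> _ ge; exists [:: coeff tt z]; rewrite big_seq1; split=> // y.
  by rewrite inE => /eqP ->; exists e.
- by move=> c; exists << c%:A *g tt >>; rewrite /stage0_aug coeffU mulr1 residue_cst.
- move=> z; rewrite /stage0_aug; split=> [/residue_eq0|].
    by move/(cover_im stage0_P).
  by move=> h; apply/residue_eq0; apply/(cover_im stage0_P).
- by move=> k z; apply: (cover_im (st_P (stages k.+1))).
Qed.

End ResolutionExists.

(* -------------------------------------------------------------------- *)
(** * Rees rings                                                         *)

Section Rees.
Variables (K : fieldType) (N : nat).
Local Notation R := {mpoly K[N]}.

(** For a subset [I] of [R], the subalgebra [R[It]] of [R[t]]; the variable
    [t] is ['X]. *)
Inductive in_rees (I : R -> Prop) : {poly R} -> Prop :=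
| in_rees_C r : in_rees I r%:P
| in_rees_t r : I r -> in_rees I (r *: 'X)
| in_rees_D f g : in_rees I f -> in_rees I g -> in_rees I (f + g)
| in_rees_M f g : in_rees I f -> in_rees I g -> in_rees I (f * g).

Definition rees_pred (I : R -> Prop) : {pred {poly R}} :=
  [pred f | `[< in_rees I f >]].

Lemma rees_subring I : subring_closed (rees_pred I).
Proof.
split=> [|f g /asboolP hf /asboolP hg|f g /asboolP hf /asboolP hg];
  apply/asboolP; first by rewrite -[1]/(1%:P); apply: in_rees_C.
- apply: in_rees_D => //; rewrite -mulN1r -[- 1](rmorphN (@polyC R) 1).
  by apply: in_rees_M => //; apply: in_rees_C.
- exact: in_rees_M.
Qed.

HB.instance Definition _ I :=
  GRing.isSubringClosed.Build {poly R} (rees_pred I) (rees_subring I).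

Record rees (I : R -> Prop) := Rees {
  rees_val :> {poly R};
  _ : rees_val \in rees_pred I
}.

HB.instance Definition _ I := [isSub for @rees_val I].
HB.instance Definition _ I := [Choice of rees I by <:].
HB.instance Definition _ I :=
  [SubChoice_isSubComNzRing of rees I by <:].

Definition rees_cst I (c : K) : rees I :=
  Rees (introT (asboolP _) (in_rees_C I c%:MP)).

Definition rees_scale I (c : K) (f : rees I) : rees I := rees_cst I c * f.

Fact rees_scaleA I a b (f : rees I) :
  rees_scale a (rees_scale b f) = rees_scale (a * b) f.
Proof.
by rewrite /rees_scale mulrA; congr (_ * _); apply: val_inj; rewrite /= !rmorphM.
Qed.

Fact rees_scale1 I : left_id 1 (@rees_scale I).
Proof.
move=> f; rewrite /rees_scale -[RHS]mul1r; congr (_ * _); apply: val_inj.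
by rewrite /= !rmorph1.
Qed.

Fact rees_scaleDr I : right_distributive (@rees_scale I) +%R.
Proof. by move=> a f g; rewrite /rees_scale mulrDr. Qed.

Fact rees_scaleDl I (f : rees I) : {morph (@rees_scale I)^~ f : a b / a + b}.
Proof.
move=> a b; rewrite /rees_scale -mulrDl; congr (_ * _); apply: val_inj.
by rewrite /= !rmorphD.
Qed.

HB.instance Definition _ I := GRing.Zmodule_isLmodule.Build K (rees I)
  (@rees_scaleA I) (@rees_scale1 I) (@rees_scaleDr I) (@rees_scaleDl I).

Fact rees_scaleAl I (a : K) (f g : rees I) : a *: (f * g) = a *: f * g.
Proof. exact: mulrA. Qed.

HB.instance Definition _ I :=
  GRing.Lmodule_isLalgebra.Build K (rees I) (@rees_scaleAl I).
HB.instance Definition _ I :=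
  GRing.Lalgebra_isComAlgebra.Build K (rees I).

(** The total degree of the bigrading with [deg x_i = (1, 0)] and
    [deg t = (-2, 1)], in which [x^m t^k] has bidegree [(mdeg m - 2k, k)]. *)
Definition rees_gr I (n : nat) (f : rees I) : Prop :=
  forall k m, m \in msupp (rees_val f)`_k ->
    (mdeg m)%:Z - 2 * k%:Z + k%:Z = n%:Z.

End Rees.

(* -------------------------------------------------------------------- *)
(** * The ideal of a rational normal scroll                              *)

Section Scroll.
Variables (K : fieldType) (d : nat) (n : 'I_d -> nat).

(** The index set of the variables [x_(i, j)] for [0 <= j <= n i]. *)
Definition scroll_var := {i : 'I_d & 'I_(n i).+1}.

Definition scroll_ring := {mpoly K[#|{: scroll_var}|]}.

Definition scroll_x (i : 'I_d) (j : 'I_(n i).+1) : scroll_ring :=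
  'X_(enum_rank (Tagged (fun i => 'I_(n i).+1) j)).

(** Column [j] of block [i]. *)
Definition scroll_col := {i : 'I_d & 'I_(n i)}.

(** The [2 x c] matrix, with rows [x_(i, j)] and [x_(i, j + 1)]; the order in
    which the columns are enumerated does not matter. *)
Definition scroll_mx : 'M[scroll_ring]_(2, #|{: scroll_col}|) :=
  \matrix_(r, k) let c : scroll_col := enum_val k in
    scroll_x (inord (tagged c + r) : 'I_(n (tag c)).+1).

Definition scroll_minor (p q : 'I_#|{: scroll_col}|) : scroll_ring :=
  scroll_mx 0 p * scroll_mx 1 q - scroll_mx 0 q * scroll_mx 1 p.

(** The ideal generated by the [2 x 2] minors. *)
Definition scroll_ideal (f : scroll_ring) : Prop :=
  exists a : 'I_#|{: scroll_col}| -> 'I_#|{: scroll_col}| -> scroll_ring,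
    f = \sum_(p < #|{: scroll_col}|) \sum_(q < #|{: scroll_col}| | (p < q)%N)
      a p q * scroll_minor p q.

Definition scroll_rees := rees scroll_ideal.

End Scroll.

(* Main.v *)
Require Import Defs.
From HB Require Import structures.
From mathcomp Require Import all_boot all_algebra.
From mathcomp Require Import boolp mpoly freeg.
From mathcomp Require Import zify ring.

Set Implicit Arguments.
Unset Strict Implicit.
Unset Printing Implicit Defensive.

Import GRing.Theory.
Local Open Scope ring_scope.

(** The Rees ring is defined by quadratic relations that form a Groebner basis,
    and an algebra with a quadratic Groebner basis is Koszul.

    The algebra is generated by letters: the variables, and the elements
    [f_pq t] where [f_pq] is the minor of the columns [p] and [q].  A symmetric
    relation [bad] on letters is chosen such that
    - the product of two letters that are [bad] together is a combination of
      products of two letters of smaller total weight ([rewrite_bad]);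
    - the products of the words without bad pairs (the standard words) are
      linearly independent ([rx_free]).

    These two facts give Koszulness ([quadratic_basis_Koszul]) because they are
    inherited by syzygies.  Call a finite family of vectors over the algebra a
    system when, with respect to leading terms [x_t e_y], it is given by linear
    rewriting rules and the irreducible products are independent; the letters
    form a system.  The linear syzygies read off from the rules again form a
    system, and they generate all syzygies ([system_step]).  So each step of a
    resolution of [K] raises degrees by exactly one, which [tor_system] turns
    into the vanishing of Tor off the diagonal for an arbitrary resolution.

    For the rewriting rules, put the columns on a line, in the order of [pos].
    A minor is a chord with ends [p] and [q]; two crossing chords are uncrossed
    by the Pluecker relation.  A variable, as the top entry of a column [r],
    behaves like a chord from a base point on the left to [r], and is uncrossed
    by the expansion of a determinant with a repeated row.  Any uncrossing
    shortens chords, as measured by a strictly concave function ([hump]).  The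
    remaining relations come from the Hankel shape of the blocks: the bottom
    entry of a column is the top entry of the next one, and they lower a
    dominant weight [Phi].

    For independence, take a relation between standard words and a word of
    maximal [Phi] in it.  Capping the weights at a threshold [theta] read off
    from that word gives a weight on the variables for which each letter [f_pq]
    of the word has one leading monomial, top entry of an opener times bottom
    entry of a closer ([lpoly_leads]).  A standard word is recovered from
    its leading monomial, since the multisets of openers and closers admit only
    one matching without crossings ([alive_words_perm]).  Words of smaller
    [Phi], and words in which the cap deprives a letter of its leading monomial,
    contribute only smaller monomials, so the largest leading monomial cannot
    cancel ([words_free]).

    All this uses only how the two entries of a column are shared between
    columns and ordered, which is the setting of [staircase_Koszul]; the scroll
    is the instance where a column is ordered by its index in its block first
    and by the block next, the last columns of the blocks coming after all the
    others. *)

(** * Linear combinations of constrained generators *)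

Section LinearCombinations.
Variable K : fieldType.
Implicit Types (V W : lmodType K) (I J : finType).

(** Index sets are finite but their elements are constrained by a bare
    proposition, such as a bound on a weight; putting the constraint on the
    support of the coefficients avoids forming a subtype for it. *)
Definition lc V I (P : I -> Prop) (g : I -> V) (a : V) : Prop :=
  exists c : I -> K, (forall i, c i != 0 -> P i) /\ a = \sum_i c i *: g i.

Lemma lc0 V I P (g : I -> V) : lc P g 0.
Proof.
exists (fun=> 0); split=> [i|]; first by rewrite eqxx.
by rewrite big1 // => i _; rewrite scale0r.
Qed.

Lemma lcD V I P (g : I -> V) a b : lc P g a -> lc P g b -> lc P g (a + b).
Proof.
move=> [c [hc ->]] [e [he ->]]; exists (fun i => c i + e i); split=> [i|].
  by case: (eqVneq (c i) 0) => [->|/hc //]; rewrite add0r => /he.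
by rewrite -big_split; apply: eq_bigr => i _; rewrite scalerDl.
Qed.

Lemma lcZ V I P (g : I -> V) k a : lc P g a -> lc P g (k *: a).
Proof.
move=> [c [hc ->]]; exists (fun i => k * c i); split=> [i|].
  by rewrite mulf_eq0 negb_or => /andP[_ /hc].
by rewrite scaler_sumr; apply: eq_bigr => i _; rewrite scalerA.
Qed.

Lemma lcN V I P (g : I -> V) a : lc P g a -> lc P g (- a).
Proof. by rewrite -scaleN1r; apply: lcZ. Qed.

Lemma lcB V I P (g : I -> V) a b : lc P g a -> lc P g b -> lc P g (a - b).
Proof. by move=> ha hb; apply: lcD => //; apply: lcN. Qed.

Lemma lc_sum V I P (g : I -> V) (T : Type) (s : seq T) (Q : pred T)
    (f : T -> V) :
  (forall t, Q t -> lc P g (f t)) -> lc P g (\sum_(t <- s | Q t) f t).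
Proof. by move=> h; elim/big_ind: _ => //; [apply: lc0 | move=> *; apply: lcD]. Qed.

Lemma lc_gen V I (P : I -> Prop) (g : I -> V) i : P i -> lc P g (g i).
Proof.
move=> Pi; exists (fun j => (j == i)%:R); split=> [j|].
  by case: (eqVneq j i) => [->//|_]; rewrite eqxx.
rewrite (bigD1 i) //= eqxx scale1r big1 ?addr0 // => j /negPf ->.
by rewrite scale0r.
Qed.

Lemma lc_trans V I J (P : I -> Prop) (Q : J -> Prop) (g : I -> V) (h : J -> V) a :
  lc P g a -> (forall i, P i -> lc Q h (g i)) -> lc Q h a.
Proof.
move=> [c [hc ->]] H; apply: lc_sum => i _.
by case: (eqVneq (c i) 0) => [->|/hc/H]; [rewrite scale0r; apply: lc0 | apply: lcZ].
Qed.

Lemma lcW V I (P Q : I -> Prop) (g : I -> V) a :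
  (forall i, P i -> Q i) -> lc P g a -> lc Q g a.
Proof. by move=> PQ ha; apply: lc_trans ha _ => i /PQ; apply: lc_gen. Qed.

Lemma lc_lin V W I J (P : I -> Prop) (Q : J -> Prop) (g : I -> V) (h : J -> W)
    (f : {linear V -> W}) a :
  lc P g a -> (forall i, P i -> lc Q h (f (g i))) -> lc Q h (f a).
Proof.
move=> [c [hc ->]] H; rewrite linear_sum; apply: lc_sum => i _; rewrite linearZ /=.
by case: (eqVneq (c i) 0) => [->|/hc/H]; [rewrite scale0r; apply: lc0 | apply: lcZ].
Qed.

End LinearCombinations.

(** * Words and normal forms *)

Section Words.
Variables (K : fieldType) (A : comAlgType K) (gr : nat -> A -> Prop).
Hypothesis grA : standard_graded gr.
Variables (X : finType) (x : X -> A) (wt : X -> nat) (bad : rel X).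

Definition mon (w : seq X) : A := \prod_(u <- w) x u.
Definition weight (w : seq X) : nat := (\sum_(u <- w) wt u)%N.
Definition good (w : seq X) := pairwise (fun u v => ~~ bad u v) w.
Definition rk (u v : X) := (enum_rank u <= enum_rank v)%N.
Definition std (w : seq X) := sorted rk w && good w.

Lemma rk_trans : transitive rk.
Proof. by move=> v u w; apply: leq_trans. Qed.
Lemma rk_total : total rk.
Proof. by move=> u v; apply: leq_total. Qed.
Lemma rk_anti : antisymmetric rk.
Proof. by move=> u v /anti_leq/val_inj/enum_rank_inj. Qed.

Lemma mon_cons u w : mon (u :: w) = x u * mon w.
Proof. exact: big_cons. Qed.
Lemma mon_cat v w : mon (v ++ w) = mon v * mon w.
Proof. exact: big_cat. Qed.
Lemma mon_perm v w : perm_eq v w -> mon v = mon w.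
Proof. exact: perm_big. Qed.
Lemma weight_cons u w : weight (u :: w) = (wt u + weight w)%N.
Proof. exact: big_cons. Qed.
Lemma weight_perm v w : perm_eq v w -> weight v = weight w.
Proof. exact: perm_big. Qed.

Hypothesis bad_sym : ssrbool.symmetric bad.

Lemma good_perm v w : perm_eq v w -> good v = good w.
Proof.
have swap s1 s2 s3 : good (s1 ++ s2 ++ s3) = good (s2 ++ s1 ++ s3).
  rewrite /good !pairwise_cat !allrel_catr.
  rewrite [X in allrel X s2 s1](_ : _ = fun u v => ~~ bad v u); last first.
    by apply/funext => a; apply/funext => b; rewrite bad_sym.
  rewrite -allrelC; set p := pairwise _; set a := allrel _ s2 s1.
  set b := allrel _ s1 s3; set c := allrel _ s2 s3.
  by case: a; case: b; case: c; case: (p s1); case: (p s2); case: (p s3).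
have imp s t : perm_eq s t -> good s -> good t.
  apply: (@catCA_perm_ind X (fun r => is_true (good r)) _ s t) => s1 s2 s3.
  by rewrite swap.
by move=> vw; apply/idP/idP; apply: imp; rewrite // perm_sym.
Qed.

Lemma good_cons u w : good (u :: w) = all (fun v => ~~ bad u v) w && good w.
Proof. exact: pairwise_cons. Qed.

Lemma not_good w : ~~ good w ->
  exists z y v, bad z y /\ perm_eq w [:: z, y & v].
Proof.
elim: w => [//|z w IHw]; rewrite good_cons negb_and => /orP[|/IHw].
  move=> /allPn[y yw]; rewrite negbK => zy; exists z, y, (rem y w); split=> //.
  by rewrite perm_cons; apply: perm_to_rem.
move=> [a [b [v [ab wv]]]]; exists a, b, (z :: v); split=> //.
rewrite -(perm_cons z) in wv; apply: (perm_trans wv).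
by apply/permP => p /=; lia.
Qed.

Hypothesis rew : forall z y, bad z y ->
  lc (fun p : X * X => (wt p.1 + wt p.2 < wt z + wt y)%N)
     (fun p => x p.1 * x p.2) (x z * x y).

Let below n (N : nat) (v : n.-tuple X) : Prop := std v /\ (weight v <= N)%N.

(** Each rewriting step strictly lowers the weight, so no confluence argument is
    involved: termination alone gives a combination of standard words. *)
Lemma word_nf n (w : seq X) : size w = n ->
  lc (@below n (weight w)) (fun v => mon v) (mon w).
Proof.
have [N] := ubnP (weight w); elim: N w => [//|N IHN] w ltwN sz.
case gw: (good w); last first.
  have [z [y [v [zy wv]]]] := not_good (negbT gw).
  have szv : size v = n.-2 by have := perm_size wv; rewrite sz => ->.
  have n2 : (n.-2.+2 = n)%N by have := perm_size wv; rewrite sz => ->.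
  rewrite (mon_perm wv) !mon_cons mulrA mulrC.
  have mlin : linear (fun a => mon v * a) by move=> k a b; rewrite mulrDr scalerAr.
  pose f : {linear A -> A} := HB.pack (fun a => mon v * a)
    (GRing.isLinear.Build K A A *:%R (fun a => mon v * a) mlin).
  apply: (lc_lin (f := f) (rew zy)) => -[a b] /= lt_ab.
  rewrite mulrC -mulrA -!mon_cons.
  have lw : (weight [:: a, b & v] < weight w)%N.
    by rewrite (weight_perm wv) !weight_cons; lia.
  apply: lcW (IHN _ _ _) => [u [su lu]||]; last by rewrite /= szv.
    by split=> //; apply: leq_trans lu (ltnW lw).
  exact: leq_trans lw ltwN.
have ps := perm_sort rk w; rewrite -(mon_perm (introT permPl ps)).
have szs : size (sort rk w) == n by rewrite size_sort sz.
apply: (@lc_gen K A _ _ (fun v : n.-tuple X => mon v) (Tuple szs)).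
split=> /=; last by rewrite (weight_perm (introT permPl ps)).
by rewrite /std sort_sorted ?(good_perm (introT permPl ps)) //; apply: rk_total.
Qed.

Hypothesis indep : forall n (c : n.-tuple X -> K),
  (forall w, c w != 0 -> std w) ->
  \sum_w c w *: mon w = 0 -> forall w, c w = 0.

Section Coefficients.
Variable n : nat.

Let expand (a : A) := lc (fun v : n.-tuple X => std v) (fun v => mon v) a.

(** The coordinate on the standard word [v]; junk outside the span of standard
    words, so that it is a total function. *)
Definition cf (a : A) (v : n.-tuple X) : K :=
  if pselect (expand a) is left h then projT1 (cid h) v else 0.

Lemma cf_eq a (c : n.-tuple X -> K) v : (forall v, c v != 0 -> std v) ->
  a = \sum_v c v *: mon v -> cf a v = c v.
Proof.
move=> hc ea; rewrite /cf; case: pselect => [h|[]]; last by exists c.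
case: (cid h) => e /= [he ea']; apply/eqP; rewrite -subr_eq0; apply/eqP.
apply: (@indep n (fun v => e v - c v)) => [u|].
  case: (eqVneq (e u) 0) => [->|/he //].
  by rewrite sub0r oppr_eq0 => /hc.
under eq_bigr => u _ do rewrite scalerBl.
by rewrite sumrB -ea -ea' subrr.
Qed.

Lemma cf0 v : cf 0 v = 0.
Proof.
apply: (@cf_eq _ (fun=> 0)) => [u|]; first by rewrite eqxx.
by rewrite big1 // => u _; rewrite scale0r.
Qed.

Lemma cf_sum (I : finType) (k : I -> K) (a : I -> A) v :
  (forall i, expand (a i)) ->
  cf (\sum_i k i *: a i) v = \sum_i k i * cf (a i) v.
Proof.
move=> h; have {}h i : exists c : n.-tuple X -> K, (forall v, c v != 0 -> std v)
    /\ a i = \sum_v c v *: mon v by case: (h i) => c hc; exists c.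
have [c hc] := choice h.
rewrite (@cf_eq _ (fun v => \sum_i k i * c i v)) => [|u|].
- by apply: eq_bigr => i _; case: (hc i) => h1 /cf_eq->.
- apply: contra_neqT => nu; rewrite big1 // => i _.
  have [->|/(proj1 (hc i))] := eqVneq (c i u) 0; first by rewrite mulr0.
  by rewrite (negPf nu).
- under eq_bigr => i _ do rewrite (proj2 (hc i)) scaler_sumr.
  rewrite exchange_big; apply: eq_bigr => u _; rewrite scaler_suml.
  by apply: eq_bigr => i _; rewrite scalerA.
Qed.

Lemma expand_word w : size w = n -> expand (mon w).
Proof. by move=> /word_nf; apply: lcW => v []. Qed.

Lemma cf_word w v : size w = n -> cf (mon w) v != 0 -> (weight v <= weight w)%N.
Proof.
move=> /word_nf[c [hc e]]; rewrite (cf_eq _ _ e) => [/hc[]//|u /hc[]//].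
Qed.

Lemma cf_std (w v : n.-tuple X) : std w -> cf (mon w) v = (v == w)%:R.
Proof.
move=> sw; rewrite (@cf_eq _ (fun v => (v == w)%:R)) // => [u|].
  by case: (eqVneq u w) => [->//|_]; rewrite eqxx.
rewrite (bigD1 w) //= eqxx scale1r big1 ?addr0 // => u /negPf ->.
by rewrite scale0r.
Qed.

End Coefficients.

Hypothesis x_gr : forall u, gr 1 (x u).
Hypothesis span : forall n a, gr n a ->
  lc (fun _ : n.-tuple X => True) (fun w => mon w) a.

Lemma gr_lc n (I : finType) (P : I -> Prop) (g : I -> A) a :
  (forall i, P i -> gr n (g i)) -> lc P g a -> gr n a.
Proof.
move=> h [c [hc ->]]; elim/big_rec: _ => [|i b _ hb]; first exact: (gr_0 grA).
have [->|/hc/h] := eqVneq (c i) 0; first by rewrite scale0r add0r.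
by move=> gi; apply: (gr_lin grA).
Qed.

Lemma mon_gr w : gr (size w) (mon w).
Proof.
elim: w => [|u w IHw] /=.
  by apply/(gr_deg0 grA); exists 1; rewrite /mon big_nil scale1r.
by rewrite mon_cons -add1n; apply: (gr_mul grA).
Qed.

(** * Systems with linear syzygies *)

Section Vectors.
Variable Y : finType.

Definition dlt (y : Y) (a : A) : {ffun Y -> A} :=
  [ffun y' => if y' == y then a else 0].
Definition amul (a : A) (f : {ffun Y -> A}) : {ffun Y -> A} :=
  [ffun y => a * f y].

Fact dlt_linear y : linear (dlt y).
Proof.
move=> k a b; apply/ffunP => y'; rewrite !ffunE.
by case: eqP; rewrite // scaler0 addr0.
Qed.
HB.instance Definition _ y :=
  GRing.isLinear.Build K A {ffun Y -> A} *:%R (dlt y) (dlt_linear y).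

Fact amul_linear a : linear (amul a).
Proof. by move=> k f g; apply/ffunP => y; rewrite !ffunE mulrDr scalerAr. Qed.
HB.instance Definition _ a :=
  GRing.isLinear.Build K {ffun Y -> A} {ffun Y -> A} *:%R (amul a) (amul_linear a).

Lemma amul_dlt a y b : amul a (dlt y b) = dlt y (a * b).
Proof. by apply/ffunP => y'; rewrite !ffunE; case: eqP; rewrite // mulr0. Qed.

End Vectors.

Section Pairing.
Variables (Y Z : finType) (m : Y -> {ffun Z -> A}).

Definition pair_with (f : {ffun Y -> A}) : {ffun Z -> A} :=
  [ffun z => \sum_y f y * m y z].

Fact pair_linear : linear pair_with.
Proof.
move=> k f g; apply/ffunP => z; rewrite !ffunE scaler_sumr -big_split.
by apply: eq_bigr => y _; rewrite !ffunE mulrDl scalerAl.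
Qed.
HB.instance Definition _ :=
  GRing.isLinear.Build K {ffun Y -> A} {ffun Z -> A} *:%R pair_with pair_linear.

Lemma pair_dlt y a : pair_with (dlt y a) = amul a (m y).
Proof.
apply/ffunP => z; rewrite !ffunE (bigD1 y) //= ffunE eqxx big1 ?addr0 // => y'.
by rewrite ffunE => /negPf ->; rewrite mul0r.
Qed.

Lemma pair_amul a f : pair_with (amul a f) = amul a (pair_with f).
Proof.
apply/ffunP => z; rewrite !ffunE mulr_sumr; apply: eq_bigr => y _.
by rewrite !ffunE mulrA.
Qed.

End Pairing.

(** A Groebner basis, for the module spanned by the rows [m y], whose leading
    terms are read on the side of the coefficients: [T y t] says that the product
    [x_t m_y] reduces to products of smaller weight, and irreducible products
    are independent.  The factor [lam] makes room for [kap], which breaks ties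
    between products in which the letters have the same weight. *)
Record system (Y Z : finType) (m : Y -> {ffun Z -> A}) (T : Y -> pred X)
    (lam : nat) (kap : Y -> nat) : Prop := System {
  sys_pos : (0 < lam)%N;
  sys_rew : forall y t, T y t ->
    lc (fun p : X * Y => (lam * wt p.1 + kap p.2 < lam * wt t + kap y)%N)
       (fun p => amul (x p.1) (m p.2)) (amul (x t) (m y));
  sys_ind : forall e (c : e.-tuple X * Y -> K),
    (forall p, c p != 0 -> std p.1 && all (predC (T p.2)) p.1) ->
    \sum_p c p *: amul (mon p.1) (m p.2) = 0 -> forall p, c p = 0
}.

Section Step.
Variables (Y Z : finType) (m : Y -> {ffun Z -> A}) (T : Y -> pred X).
Variables (lam : nat) (kap : Y -> nat).
Hypothesis S : system m T lam kap.

Definition syz := {p : X * Y | T p.2 p.1}.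
Implicit Type s : syz.
Let st s := (val s).1.
Let sy s := (val s).2.

(** A rewriting rule is a syzygy: the reducible product minus its reduction. *)
Lemma syz_exists : exists sig : syz -> {ffun Y -> A}, forall s,
  lc (fun p : X * Y => (lam * wt p.1 + kap p.2 < lam * wt (st s) + kap (sy s))%N)
     (fun p => dlt p.2 (x p.1)) (dlt (sy s) (x (st s)) - sig s)
  /\ pair_with m (sig s) = 0.
Proof.
suff h s : exists g : {ffun Y -> A},
  lc (fun p : X * Y => (lam * wt p.1 + kap p.2 < lam * wt (st s) + kap (sy s))%N)
     (fun p => dlt p.2 (x p.1)) (dlt (sy s) (x (st s)) - g)
  /\ pair_with m g = 0 by case: (choice h) => sig hs; exists sig.
have [c [hc e]] := sys_rew S (valP s).
pose r := \sum_p c p *: dlt p.2 (x p.1).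
exists (dlt (sy s) (x (st s)) - r); rewrite opprB addrC subrK; split.
  by exists c.
rewrite linearB /= pair_dlt e linear_sum /= -sumrB big1 // => p _.
by rewrite linearZ /= pair_dlt subrr.
Qed.

Variable sig : syz -> {ffun Y -> A}.
Hypothesis sig_lead : forall s,
  lc (fun p : X * Y => (lam * wt p.1 + kap p.2 < lam * wt (st s) + kap (sy s))%N)
     (fun p => dlt p.2 (x p.1)) (dlt (sy s) (x (st s)) - sig s).
Hypothesis sig_ker : forall s, pair_with m (sig s) = 0.

Let ordY e (p : e.-tuple X * Y) := (lam * weight p.1 + kap p.2)%N.
Let ordS e (p : e.-tuple X * syz) :=
  (lam * (weight p.1 + wt (st p.2)) + kap (sy p.2))%N.

(** Products of a word and a basis vector split into multiples of the syzygies
    and irreducible products. *)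
Let redP e N (i : (e.-tuple X * syz) + (e.+1.-tuple X * Y)) : Prop :=
  match i with
  | inl p => (ordS p < N)%N
  | inr p => (ordY p < N)%N && (std p.1 && all (predC (T p.2)) p.1)
  end.
Let redg e (i : (e.-tuple X * syz) + (e.+1.-tuple X * Y)) : {ffun Y -> A} :=
  match i with
  | inl p => amul (mon p.1) (sig p.2)
  | inr p => dlt p.2 (mon p.1)
  end.

Lemma syz_reduce e N (w : seq X) y : size w = e.+1 ->
  (lam * weight w + kap y < N)%N -> lc (@redP e N) (@redg e) (dlt y (mon w)).
Proof.
elim: N w y => [//|N IHN] w y szw ltwN.
have IH v y' : size v = e.+1 -> (lam * weight v + kap y' < lam * weight w + kap y)%N ->
    lc (@redP e N.+1) (@redg e) (dlt y' (mon v)).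
  move=> szv ltv; apply: lcW (IHN v y' szv _); last by lia.
  by case=> p /=; lia.
have lam0 := sys_pos S.
case gw: (good w); last first.
  have [z [y' [v [zy wv]]]] := not_good (negbT gw).
  rewrite (mon_perm wv) !mon_cons mulrA mulrC -amul_dlt.
  rewrite -[amul _ _]/((@amul Y (mon v) \o dlt y) _).
  apply: (lc_lin (f := (@amul Y (mon v) \o dlt y)) (rew zy)) => -[a b] /= lt_ab.
  rewrite amul_dlt mulrC -mulrA -!mon_cons; apply: IH.
    by have := perm_size wv; rewrite szw.
  by rewrite (weight_perm wv) !weight_cons; nia.
case hT: (has (T y) w).
  have /hasP[t tw Tt] := hT; have wv := perm_to_rem tw; set v := rem t w in wv.
  have szv : size v == e by have := perm_size wv; rewrite szw => -[->].
  have [s [es1 es2]] : exists s, st s = t /\ sy s = y.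
    by exists (exist _ (t, y) Tt).
  rewrite (mon_perm wv) mon_cons mulrC -amul_dlt -es1 -es2.
  rewrite -[dlt _ _](addrNK (sig s)) linearD /=; apply: lcD.
    apply: (lc_lin (f := @amul Y (mon v)) (sig_lead s)) => -[u y'] /= lt_u.
    rewrite amul_dlt mulrC -mon_cons; apply: IH; first by rewrite /= (eqP szv).
    rewrite (weight_perm wv) !weight_cons; move: lt_u; rewrite es1 es2; nia.
  apply: (@lc_gen K _ _ _ (@redg e) (inl (Tuple szv, s))).
  rewrite /= /ordS /= es1 es2; move: ltwN; rewrite (weight_perm wv) weight_cons.
  by rewrite [(weight v + _)%N]addnC.
have ps := perm_sort rk w; rewrite -(mon_perm (introT permPl ps)).
have szs : size (sort rk w) == e.+1 by rewrite size_sort szw.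
apply: (@lc_gen K _ _ _ (@redg e) (inr (Tuple szs, y))) => /=.
rewrite /ordY /= (weight_perm (introT permPl ps)) ltwN /std sort_sorted /=; last exact: rk_total.
rewrite (good_perm (introT permPl ps)) gw /= all_predC.
by rewrite (eq_has_r (perm_mem (introT permPl ps))) hT.
Qed.

(** In a reduction of a vector of the kernel the irreducible part vanishes by
    independence, so the syzygies of the rules generate the kernel, without
    raising the weight. *)
Lemma syz_span e N f : pair_with m f = 0 ->
  lc (fun p : e.+1.-tuple X * Y => (ordY p < N)%N) (fun p => dlt p.2 (mon p.1)) f ->
  lc (fun p : e.-tuple X * syz => (ordS p < N)%N)
     (fun p => amul (mon p.1) (sig p.2)) f.
Proof.
move=> f0 hf; have [|c [hc ef]] := lc_trans (h := @redg e) (Q := @redP e N) hf.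
  by case=> w y /= ltw; apply: syz_reduce => //; rewrite size_tuple.
have [inl0 inr0] : (forall p, c (inl p) != 0 -> (ordS p < N)%N) /\
   (forall p, c (inr p) != 0 -> std p.1 && all (predC (T p.2)) p.1).
  by split=> p => [/hc //|/hc /andP[]].
rewrite big_sumType /= in ef.
have e0 : \sum_p c (inr p) *: amul (mon p.1) (m p.2) = 0.
  rewrite -[RHS]f0 ef linearD !linear_sum /= [X in X + _]big1 => [|p _]; last first.
    by rewrite linearZ /= pair_amul sig_ker linear0 scaler0.
  by rewrite add0r; apply: eq_bigr => p _; rewrite linearZ /= pair_dlt.
have := sys_ind S inr0 e0 => c0; exists (fun p => c (inl p)); split=> //.
by rewrite ef [X in _ + X]big1 ?addr0 // => p _; rewrite c0 scale0r.
Qed.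

Let C := #|X|.+1.
Let rank (u : X) : nat := enum_rank u.
(** Two rules with the leading terms [x_t e_y] and [x_z e_y] overlap in
    [x_z x_t e_y].  The overlap is charged to one of the two syzygies only, the
    one of larger rank; [syz_kap] records the rank below the weight. *)
Definition syz_bad (s : syz) : pred X :=
  [pred z | bad z (st s) || (T (sy s) z && (rank z < rank (st s))%N)].
Definition syz_kap (s : syz) : nat :=
  (C * (lam * wt (st s) + kap (sy s)) + rank (st s))%N.

Let rank_lt u : (rank u < C)%N.
Proof. by rewrite ltnS ltnW // ltn_ord. Qed.

(** [x_z sig_s] has the leading term [x_z x_t e_y].  If [z] and [t] are bad
    together, this term can be reduced inside the algebra, otherwise it is also
    the leading term of [x_t sig_s'] with [s' = (z, y)].  In both cases what is
    left lies in the kernel with a smaller weight, where [syz_span] applies. *)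
Lemma syz_rew s z : syz_bad s z ->
  lc (fun p : X * syz => (C * lam * wt p.1 + syz_kap p.2
                          < C * lam * wt z + syz_kap s)%N)
     (fun p => amul (x p.1) (sig p.2)) (amul (x z) (sig s)).
Proof.
pose N := (lam * (wt z + wt (st s)) + kap (sy s))%N.
have lam0 := sys_pos S.
have low t s' : sy s' = sy s -> (t == z) && (st s' == st s) || (t == st s) && (st s' == z) ->
  lc (fun p : 2.-tuple X * Y => (ordY p < N)%N) (fun p => dlt p.2 (mon p.1))
     (amul (x t) (dlt (sy s') (x (st s')) - sig s')).
  move=> ey et; apply: (lc_lin (f := @amul Y (x t)) (sig_lead s')) => -[u y'] /= ltu.
  have -> : amul (x t) (dlt y' (x u)) = dlt y' (mon [tuple t; u]).
    by rewrite amul_dlt !mon_cons /mon big_nil mulr1.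
  apply: (@lc_gen K _ _ _ (fun p : 2.-tuple X * Y => dlt p.2 (mon p.1)) ([tuple t; u], y')).
  rewrite /ordY /= !weight_cons /weight big_nil addn0 /N.
  by move: ltu; rewrite ey => ltu; case/orP: et => /andP[/eqP-> /eqP e]; move: ltu; rewrite e; nia.
have done (f : {ffun Y -> A}) : pair_with m f = 0 ->
   lc (fun p : 2.-tuple X * Y => (ordY p < N)%N) (fun p => dlt p.2 (mon p.1)) f ->
   lc (fun p : X * syz => (C * lam * wt p.1 + syz_kap p.2
                          < C * lam * wt z + syz_kap s)%N)
     (fun p => amul (x p.1) (sig p.2)) f.
  move=> f0 /(syz_span f0) h; apply: lc_trans h _ => -[v s'] /= lt_v.
  have [u eu] : exists u, tval v = [:: u].
    by case: v {lt_v} => -[|u [|? ?]] //= _; exists u.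
  have -> : mon v = x u by rewrite eu mon_cons /mon big_nil mulr1.
  apply: (@lc_gen K _ _ _ (fun p : X * syz => amul (x p.1) (sig p.2)) (u, s')).
  move: lt_v; rewrite /ordS /= eu weight_cons /weight big_nil addn0.
  rewrite /N /syz_kap; have := rank_lt (st s'); have := rank_lt (st s).
  move: (rank (st s')) (rank (st s)) (wt u) (wt (st s')) (kap _) => a b c d k.
  move: (wt z) (wt (st s)) (kap _) => c' d' k' ha hb h.
  have : (C * (lam * (c + d) + k).+1 <= C * (lam * (c' + d') + k'))%N by rewrite leq_mul.
  by rewrite mulnSr !mulnDr !mulnA; lia.
have ks t s' : pair_with m (amul (x t) (sig s')) = 0.
  by rewrite pair_amul sig_ker linear0.
case/orP => [zbad|/andP[Tz ltz]].
  apply: done => //.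
  have -> : amul (x z) (sig s) = dlt (sy s) (x z * x (st s))
     - amul (x z) (dlt (sy s) (x (st s)) - sig s).
    by rewrite linearB /= amul_dlt opprB addrC subrK.
  apply: lcB; last by apply: low; rewrite ?eqxx.
  apply: (lc_lin (f := dlt (sy s)) (rew zbad)) => -[a b] /= ltab.
  have -> : x a * x b = mon [tuple a; b] by rewrite !mon_cons /mon big_nil mulr1.
  apply: (@lc_gen K _ _ _ (fun p : 2.-tuple X * Y => dlt p.2 (mon p.1)) ([tuple a; b], sy s)).
  by rewrite /ordY /= !weight_cons /weight big_nil addn0 /N; nia.
have [s' [es1 es2]] : exists s', st s' = z /\ sy s' = sy s.
  by exists (exist _ (z, sy s) Tz).
rewrite -[amul _ _](subrK (amul (x (st s)) (sig s'))); apply: lcD.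
  apply: done; first by rewrite linearB /= !ks subrr.
  have -> : amul (x z) (sig s) - amul (x (st s)) (sig s') =
    amul (x (st s)) (dlt (sy s') (x (st s')) - sig s')
    - amul (x z) (dlt (sy s) (x (st s)) - sig s).
    rewrite !linearB /= !amul_dlt es1 es2 [x z * _]mulrC.
    by rewrite opprK [RHS]addrACA subrr add0r addrC.
  by apply: lcB; apply: low; rewrite ?es1 ?es2 ?eqxx ?orbT.
apply: (@lc_gen K _ _ _ (fun p : X * syz => amul (x p.1) (sig p.2)) (st s, s')).
rewrite /syz_kap /= es1 es2; move: ltz; move: (rank z) (rank (st s)) => a b; nia.
Qed.

(** The products of a word [w] and [sig_s] allowed here have the distinct leading
    terms [t w e_y], with [t w] standard: [t] is the letter of smallest rank in
    [t w] that is reducible on [y], hence [w] and [s] are determined by the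
    product.  Taking coordinates on the largest leading term in a relation gives
    the independence. *)
Lemma syz_ind e (c : e.-tuple X * syz -> K) :
  (forall p, c p != 0 -> std p.1 && all (predC (syz_bad p.2)) p.1) ->
  \sum_p c p *: amul (mon p.1) (sig p.2) = 0 -> forall p, c p = 0.
Proof.
move=> hc c0 p1; apply/eqP/negPn/negP => cp1.
case: (@arg_maxnP _ p1 (fun p => c p != 0) (@ordS e) cp1) => -[w0 s0] cp0 max0.
have [sw0 aw0] := andP (hc _ cp0).
have good_tw (w : e.-tuple X) s : std w -> all (predC (syz_bad s)) w -> good (st s :: w).
  move=> /andP[_ gw] aw; rewrite good_cons gw andbT.
  by apply: sub_all aw => u; rewrite /= negb_or bad_sym => /andP[].
have v0s : size (sort rk (st s0 :: w0)) == e.+1 by rewrite size_sort /= size_tuple.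
pose v0 : e.+1.-tuple X := Tuple v0s.
have pv0 : perm_eq v0 (st s0 :: w0) by rewrite /= perm_sort.
have sv0 : std v0.
  by rewrite /std (good_perm pv0) good_tw // sort_sorted //; apply: rk_total.
have wv0 : weight v0 = (weight w0 + wt (st s0))%N.
  by rewrite (weight_perm pv0) weight_cons addnC.
pose small a := lc (fun v : e.+1.-tuple X => std v) (fun v => mon v) a /\ cf a v0 = 0.
have cfE (k : K) a b : lc (fun v : e.+1.-tuple X => std v) (fun v => mon v) a ->
    lc (fun v : e.+1.-tuple X => std v) (fun v => mon v) b ->
    cf (a - b) v0 = cf a v0 - cf b v0.
  move=> ha hb; have := @cf_sum e.+1 bool (fun i => if i then 1 else -1)
    (fun i => if i then a else b) v0.
  by rewrite !big_bool /= scale1r scaleN1r mul1r mulN1r => -> // -[].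
have term p : c p != 0 ->
    lc (fun v : e.+1.-tuple X => std v) (fun v => mon v) (mon p.1 * sig p.2 (sy s0))
    /\ cf (mon p.1 * sig p.2 (sy s0)) v0 = (p == (w0, s0))%:R.
  case: p => w s cp; have [sw aw] := andP (hc _ cp) => /=.
  have szc u : size (u :: w) = e.+1 by rewrite /= size_tuple.
  have [k [hk ek]] := sig_lead s.
  pose lo := \sum_q k q *: (mon w * dlt q.2 (x q.1) (sy s0)).
  have lo1 q : lc (fun v : e.+1.-tuple X => std v) (fun v => mon v)
      (mon w * dlt q.2 (x q.1) (sy s0)).
    rewrite ffunE; case: eqP => _; last by rewrite mulr0; apply: lc0.
    by rewrite mulrC -mon_cons; apply: expand_word.
  have elo : mon w * sig s (sy s0) = mon w * dlt (sy s) (x (st s)) (sy s0) - lo.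
    have -> : sig s = dlt (sy s) (x (st s)) - (dlt (sy s) (x (st s)) - sig s).
      by rewrite opprB addrC subrK.
    rewrite ek ffunE mulrDr; congr (_ + _); rewrite ffunE mulrN; congr (- _).
    rewrite sum_ffunE mulr_sumr; apply: eq_bigr => q _.
    by rewrite ffunE scalerAr.
  have lo0 : cf lo v0 = 0.
    rewrite cf_sum // big1 // => q _.
    have [->|/hk ltq] := eqVneq (k q) 0; first by rewrite mul0r.
    suff -> : cf (mon w * dlt q.2 (x q.1) (sy s0)) v0 = 0 by rewrite mulr0.
    apply/eqP/negPn/negP; rewrite ffunE; case: (eqVneq (sy s0) q.2) => eq2.
      rewrite mulrC -mon_cons => /(cf_word (szc _)).
      have := max0 _ cp; rewrite /ordS /= wv0 weight_cons.
      have := sys_pos S; move: ltq; rewrite eq2 /=; nia.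
    by rewrite mulr0 cf0 eqxx.
  have main : lc (fun v : e.+1.-tuple X => std v) (fun v => mon v)
      (mon w * dlt (sy s) (x (st s)) (sy s0)).
    rewrite ffunE; case: eqP => _; last by rewrite mulr0; apply: lc0.
    by rewrite mulrC -mon_cons; apply: expand_word.
  have lolc : lc (fun v : e.+1.-tuple X => std v) (fun v => mon v) lo.
    by apply: lc_sum => q _; apply: lcZ.
  rewrite elo; split; first exact: lcB.
  rewrite (cfE 0) // lo0 subr0 ffunE; case: (eqVneq (sy s0) (sy s)) => eys; last first.
    rewrite mulr0 cf0; case: eqP => // -[_ es].
    by move: eys; rewrite es eqxx.
  rewrite mulrC -mon_cons.
  have vs : size (sort rk (st s :: w)) == e.+1 by rewrite size_sort szc.
  have pv : perm_eq (Tuple vs) (st s :: w) by rewrite /= perm_sort.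
  have sv : std (Tuple vs).
    by rewrite /std (good_perm pv) good_tw // sort_sorted //; apply: rk_total.
  rewrite -(mon_perm pv) cf_std //; congr (nat_of_bool _)%:R.
  apply/eqP/eqP => [ev|[ew es]]; last by apply: val_inj; rewrite /= ew es.
  have pw : perm_eq (st s0 :: w0) (st s :: w).
    by rewrite perm_sym in pv0; apply: perm_trans pv0 _; rewrite ev.
  (* otherwise each of the two letters occurs in the other word, and the one of
     smaller rank is forbidden there *)
  have est : st s = st s0.
    apply/eqP/negPn/negP => nst.
    have in0 : st s \in tval w0.
      by have := perm_mem pw (st s); rewrite !inE eqxx (negPf nst).
    have in1 : st s0 \in tval w.
      have := perm_mem pw (st s0); rewrite !inE eqxx /= => /esym.
      by rewrite eq_sym (negPf nst).
    have T0 : T (sy s0) (st s) by rewrite eys; apply: (valP s).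
    have T1 : T (sy s) (st s0) by rewrite -eys; apply: (valP s0).
    have := allP aw0 _ in0; have := allP aw _ in1.
    rewrite /= !negb_or T0 T1 /= -!leqNgt => /andP[_ h1] /andP[_ h2].
    by move/negP: nst; apply; apply/eqP/enum_rank_inj/val_inj/anti_leq; rewrite h1 h2.
  have es : s = s0.
    apply: val_inj; move: est eys; rewrite /st /sy.
    by case: (val s) (val s0) => [a b] [a' b'] /= -> ->.
  rewrite est perm_cons in pw; congr (_, _); last by [].
  apply: val_inj; apply: (sorted_eq rk_trans rk_anti).
  - by case/andP: sw.
  - by case/andP: sw0.
  - by rewrite perm_sym.
have := congr1 (fun f : {ffun Y -> A} => f (sy s0)) c0.
rewrite sum_ffunE ffunE (eq_bigr (fun p => c p *: (if c p == 0 then 0 else mon p.1 * sig p.2 (sy s0)))).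
  move=> sum0; have := @cf_sum e.+1 _ c
    (fun p => if c p == 0 then 0 else mon p.1 * sig p.2 (sy s0)) v0.
  rewrite sum0 cf0 => h.
  have {}h : 0 = c (w0, s0).
    rewrite h => [|p]; last by case: eqP => [_|/eqP/term[]//]; apply: lc0.
    rewrite (bigD1 (w0, s0)) //= (negPf cp0) (proj2 (term _ cp0)) eqxx mulr1.
    rewrite big1 ?addr0 // => p np; case: (eqVneq (c p) 0) => [->|cp].
      by rewrite mul0r.
    by rewrite (proj2 (term _ cp)) (negPf np) mulr0.
  by move: cp0; rewrite -h eqxx.
move=> p _; rewrite !ffunE; case: eqP => [->|//]; by rewrite !scale0r.
Qed.

Lemma syz_system : system sig syz_bad (C * lam) syz_kap.
Proof.
split; [|exact: syz_rew | exact: syz_ind].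
by rewrite muln_gt0 (sys_pos S).
Qed.

Lemma syz_kernel e (f : {ffun Y -> A}) : (forall y, gr e (f y)) ->
  pair_with m f = 0 ->
  f = 0 \/ exists2 e', e = e'.+1 & exists b : syz -> A,
    (forall s, gr e' (b s)) /\ forall y, f y = \sum_s b s * sig s y.
Proof.
move=> fgr f0.
have lcf : lc (fun _ : e.-tuple X * Y => True) (fun p => dlt p.2 (mon p.1)) f.
  have -> : f = \sum_y dlt y (f y).
    apply/ffunP => y; rewrite sum_ffunE (bigD1 y) //= ffunE eqxx big1 ?addr0 //.
    by move=> y' ny; rewrite ffunE eq_sym (negPf ny).
  apply: lc_sum => y _; apply: (lc_lin (f := dlt y) (span (fgr y))) => w _.
  exact: (@lc_gen K _ _ _ (fun p : e.-tuple X * Y => dlt p.2 (mon p.1)) (w, y)).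
case: e fgr lcf => [|e] fgr [c [_ ef]].
  left; rewrite ef big1 // => p _; suff -> : c p = 0 by rewrite scale0r.
  apply: (sys_ind S) => [q _|]; first by rewrite [q.1]tuple0.
  rewrite -[RHS]f0 ef linear_sum /=; apply: eq_bigr => q _.
  by rewrite linearZ /= pair_dlt.
right; exists e => //; pose N := (\max_p @ordY e.+1 p).+1.
have [|b [_ eb]] := @syz_span e N f f0.
  exists c; split=> // p _; rewrite ltnS; exact: leq_bigmax.
exists (fun s => \sum_(v : e.-tuple X) b (v, s) *: mon v); split=> [s|y].
  apply: (gr_lc (P := fun _ : e.-tuple X => True) (g := fun v => mon v)) => [v _|].
    by rewrite -{1}(size_tuple v); apply: mon_gr.
  by exists (fun v => b (v, s)).
rewrite eb sum_ffunE; under [RHS]eq_bigr => s _ do rewrite mulr_suml.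
rewrite exchange_big pair_big; apply: eq_bigr => -[v s] _ /=.
by rewrite !ffunE scalerAl.
Qed.

End Step.

Lemma system_step (Y Z : finType) (m : Y -> {ffun Z -> A}) T lam kap : system m T lam kap ->
  exists (Y' : finType) (m' : Y' -> {ffun Y -> A}) T' lam' kap',
  [/\ system m' T' lam' kap', forall s, pair_with m (m' s) = 0 &
    forall e (f : {ffun Y -> A}), (forall y, gr e (f y)) -> pair_with m f = 0 ->
    f = 0 \/ exists2 e', e = e'.+1 & exists b : Y' -> A,
      (forall s, gr e' (b s)) /\ forall y, f y = \sum_s b s * m' s y].
Proof.
move=> S; have [sig hs] := syz_exists S.
exists (syz T), sig, (@syz_bad _ T), (#|X|.+1 * lam)%N, (@syz_kap _ T lam kap).
have h1 s := proj1 (hs s); have h2 s := proj2 (hs s).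
by split=> //; [exact: (syz_system S h1 h2) | exact: (syz_kernel S h1 h2)].
Qed.

Let letter (u : X) : {ffun unit -> A} := [ffun=> x u].
Let C := #|X|.+1.
Let rank (u : X) : nat := enum_rank u.

(** The first syzygies of the residue field: the letters, as vectors of length
    one.  The product [x_t x_y] with [t] of smaller rank than [y] reduces to
    [x_y x_t], which expresses commutativity. *)
Lemma letters_system :
  system letter (fun y => [pred z | bad z y || (rank z < rank y)%N]) C
    (fun y => C * wt y + rank y)%N.
Proof.
have rank_lt u : (rank u < C)%N by rewrite ltnS ltnW ?ltn_ord.
split=> // [y t /orP[tbad|ltt]|e c hc c0 [w y]].
- pose g (a : A) : {ffun unit -> A} := [ffun=> a].
  have glin : linear g by move=> k a b; apply/ffunP => z; rewrite !ffunE.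
  pose f : {linear A -> {ffun unit -> A}} := HB.pack g
    (GRing.isLinear.Build K A {ffun unit -> A} *:%R g glin).
  have -> : amul (x t) (letter y) = f (x t * x y) by apply/ffunP => z; rewrite !ffunE.
  apply: (lc_lin (f := f) (rew tbad)) => -[a b] /= ltab.
  have -> : g (x a * x b) = amul (x a) (letter b) by apply/ffunP => z; rewrite !ffunE.
  apply: (@lc_gen K _ _ _ (fun p : X * X => amul (x p.1) (letter p.2)) (a, b)) => /=.
  have := rank_lt b; have : (C * (wt a + wt b).+1 <= C * (wt t + wt y))%N by rewrite leq_mul.
  by rewrite mulnSr !mulnDr; lia.
- have -> : amul (x t) (letter y) = amul (x y) (letter t).
    by apply/ffunP => z; rewrite !ffunE mulrC.
  apply: (@lc_gen K _ _ _ (fun p : X * X => amul (x p.1) (letter p.2)) (y, t)) => /=.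
  by move: ltt; lia.
pose cc (v : e.+1.-tuple X) : K := c ([tuple of behead v], thead v).
have stdc (v : e.-tuple X) u : c (v, u) != 0 -> std (u :: v).
  move=> /hc /andP[/= /andP[sv gv] /allP av]; apply/andP; split.
    rewrite (sorted_pairwise rk_trans) pairwise_cons -(sorted_pairwise rk_trans) sv andbT.
    by apply/allP => z /av; rewrite /= negb_or -leqNgt => /andP[].
  rewrite good_cons gv andbT; apply/allP => z /av.
  by rewrite /= negb_or bad_sym => /andP[].
have ccE (v : e.-tuple X) u : cc [tuple of u :: v] = c (v, u).
  by rewrite /cc theadE; congr (c (_, _)); apply: val_inj.
rewrite -ccE; apply: indep => [v|].
  by rewrite [v]tuple_eta ccE => /stdc.
have := congr1 (fun f : {ffun unit -> A} => f tt) c0; rewrite sum_ffunE ffunE.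
rewrite (reindex (fun p : e.-tuple X * X => [tuple of p.2 :: p.1])) /=; last first.
  exists (fun v : e.+1.-tuple X => ([tuple of behead v], thead v)) => [[v u] _|v _] /=.
    by rewrite theadE; congr (_, _); apply: val_inj.
  by rewrite [RHS]tuple_eta.
move=> h; rewrite -[RHS]h; apply: eq_bigr => -[v u] _ /=.
by rewrite ccE !ffunE mon_cons mulrC.
Qed.

(** * Vanishing of Tor *)

Section Resolution.
Variables (G : nat -> choiceType) (deg : forall i, G i -> int).
Variable d : forall i, {linear {freeg (G i.+1) / A} -> {freeg (G i) / A}}.
Variable aug : {additive {freeg (G 0) / A} -> K}.
Hypothesis d_hom : forall i j z, fhomog gr (@deg i.+1) j z ->
  fhomog gr (@deg i) j (d i z).
Hypothesis aug_hom : forall j z, j != 0 -> fhomog gr (@deg 0) j z -> aug z = 0.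
Hypothesis exact0 : forall z, aug z = 0 <-> exists y, z = d 0 y.
Hypothesis exactS : forall i z, d i z = 0 <-> exists y, z = d i.+1 y.

(** A sequence [D] containing the support is given because coefficient functions
    are chosen pointwise below. *)
Lemma freeg_of_coeff (B : choiceType) (D : seq B) (k : B -> A) :
  exists z : {freeg B / A}, forall b, coeff b z = if b \in D then k b else 0.
Proof.
exists (\sum_(b <- undup D) << k b *g b >>) => b; rewrite raddf_sum /=.
rewrite -mem_undup; have := undup_uniq D; elim: (undup D) => [|b' s IHs] /=.
  by rewrite big_nil.
move=> /andP[b's us]; rewrite big_cons IHs // coeffU inE [b == b']eq_sym.
case: eqP => [<-|_] /=; last by rewrite mulr0 add0r.
by rewrite (negPf b's) mulr1 addr0.
Qed.

Definition cycle i : {freeg (G i) / A} -> Prop :=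
  match i with 0 => fun=> True | k.+1 => fun z => d k z = 0 end.

Lemma boundary_cycle i z : cycle (d i z).
Proof. by case: i z => //= i z; apply/exactS; exists z. Qed.

(** This is the vanishing off the diagonal of the homology of [F (x) M], where [M]
    is the module generated by the vectors [m y], by induction on the homological
    degree.  The cycle condition puts the differentials [d (g y)] in
    the kernel of [m], which the next system generates in one degree less; so
    they come from elements of degree [j - 1] in homological degree one less. *)
Lemma tor_system i : forall (Y Z : finType) (m : Y -> {ffun Z -> A}) T lam kap,
  system m T lam kap ->
  forall (j : int) (g : Y -> {freeg (G i) / A}), i%:Z != j ->
  (forall y, fhomog gr (@deg i) j (g y)) ->
  (forall z, cycle (\sum_y m y z *: g y)) ->
  exists h : Y -> {freeg (G i.+1) / A}, forall z,
    \sum_y m y z *: (g y - d i (h y)) = 0.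
Proof.
elim: i => [|k IHk] Y Z m T lam kap S j g ij ghom cyc.
  have ex y : exists h, g y = d 0 h.
    by apply/exact0; apply: aug_hom (ghom y); rewrite eq_sym.
  have [h hh] := choice ex; exists h => z.
  by rewrite big1 // => y _; rewrite hh subrr scaler0.
have [Y' [m' [T' [lam' [kap' [S' mm' ker]]]]]] := system_step S.
pose c y := d k (g y).
have chom y : fhomog gr (@deg k) j (c y) by apply: d_hom.
have lift b : exists bb : Y' -> A,
    (forall y, coeff b (c y) = \sum_s bb s * m' s y) /\
    forall s, bb s = 0 \/ exists2 e : nat, j - 1 = deg b + e%:Z & gr e (bb s).
  pose f := [ffun y => coeff b (c y)].
  have f0 : pair_with m f = 0.
    apply/ffunP => z; rewrite !ffunE; have := congr1 (coeff b) (cyc z).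
    rewrite coeff0 linear_sum raddf_sum /= => h0; rewrite -[RHS]h0; apply: eq_bigr => y _.
    by rewrite ffunE linearZ /= coeffZ mulrC.
  have [fz|fnz] := eqVneq f 0.
    exists (fun=> 0); split=> [y|s]; last by left.
    have := congr1 (fun f : {ffun Y -> A} => f y) fz; rewrite !ffunE => ->.
    by rewrite big1 // => s _; rewrite mul0r.
  have [e ej] : exists e : nat, j = deg b + e%:Z.
    have [y ny] : exists y, f y != 0.
      apply/existsP; apply: contraNT fnz; rewrite negb_exists => /forallP f1.
      by apply/eqP/ffunP => y; rewrite [RHS]ffunE; apply/eqP/negPn.
    by move: ny; rewrite ffunE; case: (chom y b) => [->|[e -> _] _]; [rewrite eqxx | exists e].
  have fgr y : gr e (f y).
    rewrite ffunE; case: (chom y b) => [->|[e' ej' ge]]; first exact: (gr_0 grA).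
    by move: ej'; rewrite ej => /addrI[->].
  have [fz|[e' ee' [bb [bbgr bbE]]]] := ker _ _ fgr f0.
    by rewrite fz eqxx in fnz.
  exists bb; split=> [y|s]; first by rewrite -bbE ffunE.
  right; exists e' => //; rewrite ej ee' -addn1 PoszD; lia.
have [bb hbb] := choice lift.
pose D := flatten [seq dom (c y) | y : Y].
have inD b y : b \notin D -> coeff b (c y) = 0.
  move=> bD; apply: coeff_outdom; apply: contra bD => bc.
  by apply/flatten_mapP; exists y; rewrite ?mem_enum.
have ex' s := freeg_of_coeff D (fun b => bb b s).
have [c' hc'] := choice ex'.
have cE y : c y = \sum_s m' s y *: c' s.
  apply/eqP/freeg_eqP => b; rewrite raddf_sum /=.
  case bD: (b \in D).
    rewrite (proj1 (hbb b)); apply: eq_bigr => s _.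
    by rewrite coeffZ hc' bD mulrC.
  rewrite inD ?bD // big1 // => s _; by rewrite coeffZ hc' bD mulr0.
have c'hom s : fhomog gr (@deg k) (j - 1) (c' s).
  by move=> b; rewrite hc'; case: ifP => _; [apply: (proj2 (hbb b)) | left].
have kj : k%:Z != j - 1 by apply: contra ij => /eqP; lia.
have [|h' hh'] := IHk Y' Y m' T' lam' kap' S' (j - 1) c' kj c'hom.
  by move=> y; rewrite -cE; apply: boundary_cycle.
have ex2 y : exists h, g y - \sum_s m' s y *: h' s = d k.+1 h.
  apply/exactS; rewrite linearB linear_sum /=.
  under eq_bigr => s _ do rewrite linearZ /=.
  rewrite -/(c y) cE -sumrB -[RHS](hh' y); apply: eq_bigr => s _.
  by rewrite scalerBr.
have [h hh] := choice ex2; exists h => z.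
under eq_bigr => y _ do rewrite -hh opprB addrC subrK scaler_sumr.
rewrite exchange_big big1 // => s _; under eq_bigr => y _ do rewrite scalerA.
rewrite -scaler_suml; suff -> : \sum_y m y z * m' s y = 0 by rewrite scale0r.
have := congr1 (fun f : {ffun Z -> A} => f z) (mm' s); rewrite !ffunE => h0.
by rewrite -[RHS]h0; apply: eq_bigr => y _; rewrite mulrC.
Qed.

Lemma gr_split e a : gr e.+1 a -> exists b : X -> A,
  (forall u, gr e (b u)) /\ a = \sum_u x u * b u.
Proof.
move=> /span[c [_ ->]].
pose b u := \sum_(w : e.+1.-tuple X)
  (if thead w == u then c w *: mon (behead w) else 0).
exists b; split=> [u|].
  rewrite /b; elim/big_rec: _ => [|w a' _ ha]; first exact: (gr_0 grA).
  case: ifP => _; last by rewrite add0r.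
  apply: (gr_lin grA) => //; have := mon_gr (behead w).
  by rewrite size_behead size_tuple.
under [RHS]eq_bigr => u _ do rewrite mulr_sumr.
rewrite exchange_big; apply: eq_bigr => w _; rewrite (bigD1 (thead w)) //= eqxx.
rewrite big1 ?addr0 => [|u nu]; last by rewrite eq_sym (negPf nu) mulr0.
by case/tupleP: w => u w; rewrite theadE -scalerAr -mon_cons.
Qed.

Lemma irrelevant_hom n a : gr n.+1 a -> irrelevant gr a.
Proof.
move=> ha; exists [:: a]; rewrite big_seq1; split=> // b.
by rewrite inE => /eqP->; exists n.
Qed.

(** Passing from the residue field to the irrelevant ideal, generated by the
    letters, lowers the homological degree by one; [tor_system] applies there. *)
Lemma tor_field i j z : i%:Z != j -> fhomog gr (@deg i) j z ->
  match i return {freeg (G i) / A} -> Prop with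
  | 0 => fun=> True
  | k.+1 => fun z => firrelevant gr (d k z)
  end z ->
  exists y, firrelevant gr (z - d i y).
Proof.
have irr0 : irrelevant gr 0 by exists [::]; rewrite big_nil.
case: i z => [|k] z ij zhom.
  have /exact0[y ->] : aug z = 0 by apply: aug_hom zhom; rewrite eq_sym.
  by exists y => b; rewrite subrr coeff0.
move=> dz; have dhom := d_hom zhom.
have lift b : exists bb : X -> A,
    coeff b (d k z) = \sum_u x u * bb u /\
    forall u, bb u = 0 \/ exists2 e : nat, j - 1 = deg b + e%:Z & gr e (bb u).
  have zero : coeff b (d k z) = 0 -> exists bb : X -> A,
    coeff b (d k z) = \sum_u x u * bb u /\
    forall u, bb u = 0 \/ exists2 e : nat, j - 1 = deg b + e%:Z & gr e (bb u).
    move=> ->; exists (fun=> 0); split=> [|u]; last by left.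
    by rewrite big1 // => u _; rewrite mulr0.
  case: (dhom b) => [/zero //|[[|e] ej ge]].
    apply: zero; have [a ea] := proj1 (gr_deg0 grA _) ge.
    by have := dz b; rewrite ea => /(irrelevant_cst grA)->; rewrite scale0r.
  have [bb [bbgr bbE]] := gr_split ge; exists bb; split=> // u.
  by right; exists e => //; rewrite ej -addn1 PoszD; lia.
have [bb hbb] := choice lift.
have ex' u := freeg_of_coeff (dom (d k z)) (fun b => bb b u).
have [c' hc'] := choice ex'.
have cE : d k z = \sum_u letter u tt *: c' u.
  apply/eqP/freeg_eqP => b; rewrite raddf_sum /=.
  case bD: (b \in dom (d k z)).
    rewrite (proj1 (hbb b)); apply: eq_bigr => u _.
    by rewrite coeffZ hc' bD ffunE.
  rewrite coeff_outdom ?bD // big1 // => u _; by rewrite coeffZ hc' bD mulr0.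
have c'hom u : fhomog gr (@deg k) (j - 1) (c' u).
  by move=> b; rewrite hc'; case: ifP => _; [apply: (proj2 (hbb b)) | left].
have kj : k%:Z != j - 1 by apply: contra ij => /eqP; lia.
have [|h hh] := tor_system letters_system kj c'hom.
  by case; rewrite -cE; apply: boundary_cycle.
have [y ey] : exists y, z - \sum_u x u *: h u = d k.+1 y.
  apply/exactS; rewrite linearB linear_sum /= cE -sumrB -[RHS](hh tt).
  by apply: eq_bigr => u _; rewrite linearZ /= ffunE scalerBr.
exists y => b; rewrite -ey opprB addrC subrK raddf_sum /=.
apply: (irrelevant_sum (gr := gr)) => u.
by rewrite coeffZ mulrC; apply: (irrelevantM grA); apply: irrelevant_hom (x_gr u).
Qed.

Lemma irrelevant_coeff (B : choiceType) (dg : B -> int) j (w : {freeg B / A}) b :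
  fhomog gr dg j w -> j != dg b -> irrelevant gr (coeff b w).
Proof.
move=> /(_ b)[->|[[|e] ->]]; first by exists [::]; rewrite big_nil.
  by rewrite addr0 eqxx.
by move=> /irrelevant_hom.
Qed.

(** On a generator of degree [j] the other components of [y] contribute
    coefficients of nonzero degree; on a generator of another degree, an element
    of degree [j] always has its coefficient in the irrelevant ideal. *)
Lemma homogeneous_boundary i j z y : fhomog gr (@deg i) j z ->
  firrelevant gr (z - d i y) ->
  exists2 y', fhomog gr (@deg i.+1) j y' & firrelevant gr (z - d i y').
Proof.
move=> zhom zy; have [s [hs es]] := fhomog_span grA (@deg i.+1) y.
have y'hom : fhomog gr (@deg i.+1) j (\sum_(p <- s | p.1 == j) p.2).
  by apply: (fhomog_sum grA) => p /hs hp /eqP <-.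
exists (\sum_(p <- s | p.1 == j) p.2) => // b.
have ez : z - d i (\sum_(p <- s | p.1 == j) p.2) =
    (z - d i y) + \sum_(p <- s | p.1 != j) d i p.2.
  have -> : d i y = d i (\sum_(p <- s | p.1 == j) p.2)
      + \sum_(p <- s | p.1 != j) d i p.2.
    rewrite es (bigID (fun p : int * _ => p.1 == j)) /= linearD; congr (_ + _).
    exact: linear_sum.
  by rewrite opprD addrA subrK.
have [e0|ne] := eqVneq j (deg b).
  rewrite ez coeffD raddf_sum /=; apply: (irrelevantD (gr := gr)) => //.
  rewrite big_seq_cond; elim/big_ind: _ => [|a a'|p /andP[ps pj]].
  - by exists [::]; rewrite big_nil.
  - exact: (irrelevantD (gr := gr)).
  by apply: irrelevant_coeff (d_hom (hs p ps)) _; rewrite -e0.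
apply: irrelevant_coeff ne; apply: (fhomogD grA) => //.
move=> b'; rewrite coeffN; case: (d_hom y'hom b') => [->|[e -> ge]].
  by rewrite oppr0; left.
right; exists e => //; rewrite -scaleN1r -[_ *: _]addr0.
by apply: (gr_lin grA) => //; apply: (gr_0 grA).
Qed.

End Resolution.

(** By [tor_field] a cycle is a boundary up to the irrelevant ideal, and
    [homogeneous_boundary] makes the choice of degrees compatible. *)
Theorem quadratic_basis_Koszul : Koszul gr.
Proof.
split=> // i j ij F z; case: F z => G deg d aug h1 h2 h3 h4 h5 h6 h7 z /= zhom cyc.
have [|y hy] := @tor_field G deg d aug h1 h4 h6 h7 i j z ij zhom.
  by case: i {ij} z zhom cyc.
exact: (homogeneous_boundary h1 zhom hy).
Qed.

End Words.

(** * Staircases: letters, weights and bad pairs *)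

(** Columns [C] with a top entry [va] and a bottom entry [vb] in the set [V] of
    variables, where the bottom entry of a column that is not [last] is also the
    top entry of a column.  The axioms on [ord] are what both the rewriting and
    the independence need; [ord_mono] says that passing to the next column
    preserves the order among last columns and among the others, the columns
    without a previous one coming first. *)
Section Staircase.
Variables (K : fieldType) (C V : finType) (va vb : C -> V).
Variables (ord : C -> nat) (last : pred C) (Phi : V -> nat).
Hypothesis va_inj : injective va.
Hypothesis vb_inj : injective vb.
Hypothesis ord_inj : injective ord.
Hypothesis ord_last : forall p q, ~~ last p -> last q -> (ord p < ord q)%N.
Hypothesis ord_step : forall k p, vb k = va p -> (ord k < ord p)%N.
Hypothesis last_step : forall p, reflect (exists q, va q = vb p) (~~ last p).
Hypothesis ord_mono : forall p q k, last p = last q -> vb k = va q ->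
  (forall k', vb k' = va p -> (ord k' < ord k)%N) -> (ord p < ord q)%N.
Hypothesis Phi_step : forall p, Phi (vb p) = (Phi (va p) + ord p)%N.
Hypothesis Phi_first : forall v, (forall k, vb k <> v) -> Phi v = 0%N.

Definition ord_bound := (\max_p ord p).+1.
(** The line carrying the chords: last columns come first, in reverse order. *)
Definition pos p := if last p then (ord_bound - ord p)%N else (ord_bound + ord p).+1.
Definition chord := {e : C * C | (pos e.1 < pos e.2)%N}.
Definition letter : finType := (V + chord)%type.

(** The four kinds of leading terms: crossing chords; a chord and a second one
    whose ends are both shifts of later columns [k], [l]; a variable under a
    chord; a variable that is the bottom of a column later than both ends. *)
Definition crossing (e e' : chord) :=
  [&& pos (val e).1 < pos (val e').1, pos (val e').1 < pos (val e).2
    & pos (val e).2 < pos (val e').2]%N.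
Definition shifted (e e' : chord) := [exists k, exists l,
  [&& vb k == va (val e').1, vb l == va (val e').2,
      ord (val e).1 < ord k, ord (val e).1 < ord l,
      ord (val e).2 < ord k & ord (val e).2 < ord l]]%N.
Definition under v (e : chord) :=
  [exists p, [&& va p == v, pos (val e).1 < pos p & pos p < pos (val e).2]]%N.
Definition over v (e : chord) :=
  [exists k, [&& vb k == v, ord (val e).1 < ord k & ord (val e).2 < ord k]]%N.

Definition bad1 (u u' : letter) := match u, u' with
  | inl v, inr e => under v e || over v e
  | inr e, inr e' => crossing e e' || shifted e e'
  | _, _ => false end.
Definition bad (u u' : letter) := bad1 u u' || bad1 u' u.

Lemma bad_sym : ssrbool.symmetric bad.
Proof. by move=> u u'; rewrite /bad orbC. Qed.

Lemma ord_lt p : (ord p < ord_bound)%N.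
Proof. by rewrite /ord_bound ltnS leq_bigmax. Qed.

Lemma pos_gt0 p : (0 < pos p)%N.
Proof. by rewrite /pos; case: (last p) => //; rewrite subn_gt0 ord_lt. Qed.

Definition pos_bound := (ord_bound + ord_bound).+1.
Lemma pos_lt p : (pos p < pos_bound)%N.
Proof. by rewrite /pos /pos_bound; have := ord_lt p; case: (last p) => h; lia. Qed.

Lemma pos_inj : injective pos.
Proof.
move=> p q; have := ord_lt p; have := ord_lt q; rewrite /pos.
by case: (last p); case: (last q) => hp hq e; apply: ord_inj; lia.
Qed.

(** Strictly concave on the segment from 0 to [pos_bound]. *)
Definition hump l := (l * (pos_bound - l))%N.

Lemma hump_gap a b c : (0 < a)%N -> (0 < b)%N -> (0 < c)%N -> (a + b + c < pos_bound)%N ->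
  (hump a + hump c < hump (a + b) + hump (b + c))%N /\
  (hump (a + b + c) + hump b < hump (a + b) + hump (b + c))%N.
Proof.
rewrite /hump; move: pos_bound => T a0 b0 c0 hT.
have [s s0 ->] : exists2 s, (0 < s)%N & T = (a + b + c + s)%N
  by exists (T - (a + b + c))%N; lia.
have -> : (a + b + c + s - a = b + c + s)%N by lia.
have -> : (a + b + c + s - c = a + b + s)%N by lia.
have -> : (a + b + c + s - (a + b) = c + s)%N by lia.
have -> : (a + b + c + s - (b + c) = a + s)%N by lia.
have -> : (a + b + c + s - (a + b + c) = s)%N by lia.
have -> : (a + b + c + s - b = a + c + s)%N by lia.
have h1 : (0 < b * s)%N by rewrite muln_gt0 b0.
have h2 : (0 < a * c)%N by rewrite muln_gt0 a0.
by split; rewrite !mulnDl !mulnDr; nia.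
Qed.

Lemma hump_crossing a b c e : (a < b)%N -> (b < c)%N -> (c < e)%N -> (e < pos_bound)%N ->
  (hump (b - a) + hump (e - c) < hump (c - a) + hump (e - b))%N /\
  (hump (e - a) + hump (c - b) < hump (c - a) + hump (e - b))%N.
Proof.
move=> ab bc ce eT; have := @hump_gap (b - a) (c - b) (e - c).
rewrite !subn_gt0 ab bc ce => /(_ isT isT isT).
have -> : (b - a + (c - b) = c - a)%N by lia.
have -> : (c - b + (e - c) = e - b)%N by lia.
have -> : (c - a + (e - c) = e - a)%N by lia.
by apply; lia.
Qed.

Definition len (u : letter) := match u with
  | inl v => if [pick p | va p == v] is Some p then hump (pos p) else 0%N
  | inr e => hump (pos (val e).2 - pos (val e).1) end.
Definition height (u : letter) := match u with
  | inl v => Phi v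
  | inr e => (Phi (va (val e).1) + Phi (va (val e).2))%N end.
(** Exceeds the sum of two values of [len], so that [wt] compares [height]
    first. *)
Definition scale := (2 * (pos_bound * pos_bound)).+1.
Definition wt u := (scale * height u + len u)%N.

Lemma hump_le l : (hump l <= pos_bound * pos_bound)%N.
Proof. rewrite /hump; case: (leqP l pos_bound) => h; nia. Qed.

Lemma len_le u : (len u <= pos_bound * pos_bound)%N.
Proof.
case: u => [v|e] /=; last exact: hump_le.
by case: pickP => // p _; apply: hump_le.
Qed.

Lemma len_va p : len (inl (va p)) = hump (pos p).
Proof.
rewrite /=; case: pickP => [q /eqP/va_inj -> //|/(_ p)].
by rewrite eqxx.
Qed.

Lemma wt_height u u' z y : (height u + height u' < height z + height y)%N ->
  (wt u + wt u' < wt z + wt y)%N.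
Proof.
rewrite /wt => h; have := len_le u; have := len_le u'.
rewrite /scale; nia.
Qed.

Lemma wt_len u u' z y : (height u + height u' = height z + height y)%N ->
  (len u + len u' < len z + len y)%N -> (wt u + wt u' < wt z + wt y)%N.
Proof. by rewrite /wt => h l; rewrite addnACA -mulnDr h; nia. Qed.

(** * The quadratic relations as rewriting rules *)

(** [E_plucker] is the Pluecker relation.  [E_va] and [E_vb] expand a determinant
    of size 3 with a repeated row.  For a matrix with three rows and four
    columns, [E_shift] relates the minors of the first two rows to those of the
    last two, a shifted column being formed by the last two entries. *)
Section Rewriting.
Variables (A : comAlgType K) (y : V -> A) (E : C -> C -> A).
Hypothesis E0 : forall p, E p p = 0.
Hypothesis EN : forall p q, E q p = - E p q.
Hypothesis E_plucker : forall a b c e, E a c * E b e = E a b * E c e + E a e * E b c.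
Hypothesis E_va : forall p q r, y (va r) * E p q = y (va p) * E r q + y (va q) * E p r.
Hypothesis E_vb : forall p q r, y (vb r) * E p q = y (vb p) * E r q + y (vb q) * E p r.
Hypothesis E_shift : forall i j k l i' j' k' l',
  va i' = vb i -> va j' = vb j -> va k' = vb k -> va l' = vb l ->
  E i j * E k' l' = E i k * E j' l' - E i l * E j' k' - E j k * E i' l'
                  + E j l * E i' k' - E k l * E i' j'.

Definition x (u : letter) : A := match u with
  | inl v => y v
  | inr e => E (val e).1 (val e).2 end.

Lemma E_letter p q : p != q -> exists e : chord, [/\ E p q = x (inr e) \/ E p q = - x (inr e),
  height (inr e) = (Phi (va p) + Phi (va q))%N
  & (pos p < pos q)%N -> len (inr e) = hump (pos q - pos p)].
Proof.
move=> pq; have : pos p != pos q by apply: contra_neq pq; apply: pos_inj.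
rewrite neq_ltn => /orP[] h.
  by exists (exist _ (p, q) h); split=> /=; [left | |].
by exists (exist _ (q, p) h); split=> /=; [right; exact: EN | lia | lia].
Qed.

Definition below (N : nat) (pr : letter * letter) := (wt pr.1 + wt pr.2 < N)%N.
Definition pair_mon (pr : letter * letter) := x pr.1 * x pr.2.

Lemma lc_sgn N (a b : A) : a = b \/ a = - b -> lc (below N) pair_mon b -> lc (below N) pair_mon a.
Proof. by case=> -> //; apply: lcN. Qed.

Lemma below_EE N p q r s :
  (forall e e' : chord, height (inr e) = (Phi (va p) + Phi (va q))%N ->
     height (inr e') = (Phi (va r) + Phi (va s))%N ->
     ((pos p < pos q)%N -> len (inr e) = hump (pos q - pos p)) ->
     ((pos r < pos s)%N -> len (inr e') = hump (pos s - pos r)) ->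
     (wt (inr e) + wt (inr e') < N)%N) ->
  lc (below N) pair_mon (E p q * E r s).
Proof.
move=> h; have [->|pq] := eqVneq p q; first by rewrite E0 mul0r; apply: lc0.
have [->|rs] := eqVneq r s; first by rewrite E0 mulr0; apply: lc0.
have [e [se he le]] := E_letter pq; have [e' [se' he' le']] := E_letter rs.
apply: (@lc_sgn _ _ (x (inr e) * x (inr e'))).
  by case: se se' => -> [] ->; rewrite ?mulrN ?mulNr ?opprK; auto.
by apply: (@lc_gen K _ _ _ pair_mon (inr e, inr e')); apply: h.
Qed.

Lemma below_xE N v p q :
  (forall e : chord, height (inr e) = (Phi (va p) + Phi (va q))%N ->
     ((pos p < pos q)%N -> len (inr e) = hump (pos q - pos p)) ->
     (wt (inl v) + wt (inr e) < N)%N) ->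
  lc (below N) pair_mon (y v * E p q).
Proof.
move=> h; have [->|pq] := eqVneq p q; first by rewrite E0 mulr0; apply: lc0.
have [e [se he le]] := E_letter pq.
apply: (@lc_sgn _ _ (x (inl v) * x (inr e))).
  by case: se => ->; rewrite ?mulrN ?mulNr ?opprK; auto.
by apply: (@lc_gen K _ _ _ pair_mon (inl v, inr e)); apply: h.
Qed.

(** Crossing chords and covered variables keep the height and lower the total
    length, by concavity of [hump]; for a variable the left end of its chord is at
    position 0.  The other two kinds lower the height. *)
Lemma rewrite_bad1 u u' : bad1 u u' ->
  lc (below (wt u + wt u')) pair_mon (x u * x u').
Proof.
case: u => [v|[[p q] /= pq]]; case: u' => [v'|[[r s] /= rs]] //=.
- case/orP=> [/existsP[k /and3P[/eqP <- /= h1 h2]]|/existsP[k /and3P[/eqP <- /= h1 h2]]].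
    rewrite E_va.
    have [] := hump_crossing (pos_gt0 r) h1 h2 (pos_lt s).
    rewrite !subn0 => l1 l2; apply: lcD; apply: below_xE => e he le; apply: wt_len;
      rewrite ?he ?le ?len_va /=; lia.
  rewrite E_vb.
  by apply: lcD; apply: below_xE => e he le; apply: wt_height; rewrite he /= !Phi_step; lia.
- case/orP=> [/and3P[/= h1 h2 h3]|].
    rewrite E_plucker; have [l1 l2] := hump_crossing h1 h2 h3 (pos_lt s).
    by apply: lcD; apply: below_EE => e e' he he' le le'; apply: wt_len;
      rewrite ?he ?he' ?le ?le' /=; lia.
  case/existsP=> k /existsP[l /and5P[/eqP /= ek /eqP /= el pk pl /andP[qk ql]]].
  have lk : ~~ last k by apply/last_step; exists r.
  have nl t : (ord t < ord k)%N -> ~~ last t.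
    by move=> tk; apply/negP => lt; have := ord_last lk lt; lia.
  have /last_step[p' ep] := nl _ pk; have /last_step[q' eq] := nl _ qk.
  rewrite (E_shift ep eq (esym ek) (esym el)).
  have er : Phi (va r) = (Phi (va k) + ord k)%N by rewrite -ek Phi_step.
  have es : Phi (va s) = (Phi (va l) + ord l)%N by rewrite -el Phi_step.
  have ep' : Phi (va p') = (Phi (va p) + ord p)%N by rewrite ep Phi_step.
  have eq' : Phi (va q') = (Phi (va q) + ord q)%N by rewrite eq Phi_step.
  by apply: lcB; [apply: lcD; [apply: lcB; [apply: lcB|]|]|]; apply: below_EE => e e' he he' _ _;
    apply: wt_height; rewrite ?he ?he' /=; lia.
Qed.

Lemma rewrite_bad u u' : bad u u' ->
  lc (fun p : letter * letter => (wt p.1 + wt p.2 < wt u + wt u')%N)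
     (fun p => x p.1 * x p.2) (x u * x u').
Proof.
by case/orP => /rewrite_bad1 //; rewrite addnC mulrC.
Qed.
End Rewriting.

(** * Openers, closers and the reconstruction of words *)

(** The threshold [theta] distinguishes low columns, those before it, from high
    columns, the shifts of columns after it.  A letter is alive when one of its
    monomials reaches the maximal capped weight, which is computed below: for a
    chord this fails exactly when both ends are low or both are high. *)
Section Leads.
Variable theta : nat.

Definition low p := (ord p < theta)%N.
Definition dead v := [exists k, (vb k == v) && (theta < ord k)%N].
Definition high p := dead (va p).
(** Low columns, all of rank 0, then the intermediate ones, then the high ones;
    the opener of an alive chord is the end of smaller rank. *)
Definition rank p :=
  if low p then 0%N else if high p then (ord_bound + ord p).+1 else (ord p).+1.
Definition alive (u : letter) := match u with
  | inl v => ~~ dead v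
  | inr e => ~~ (low (val e).1 && low (val e).2) && ~~ (high (val e).1 && high (val e).2)
  end.
Definition opener (e : chord) :=
  if (rank (val e).1 < rank (val e).2)%N then (val e).1 else (val e).2.
Definition closer (e : chord) :=
  if (rank (val e).1 < rank (val e).2)%N then (val e).2 else (val e).1.

Lemma highP p : reflect (exists2 k, vb k = va p & (theta < ord k)%N) (high p).
Proof.
apply: (iffP existsP) => [[k /andP[/eqP e h]]|[k e h]]; first by exists k.
by exists k; rewrite e eqxx.
Qed.

Lemma high_not_low p : high p -> ~~ low p.
Proof. by case/highP => k /ord_step h t; rewrite /low -leqNgt; lia. Qed.

Lemma rank_inj p q : ~~ low q -> rank p = rank q -> p = q.
Proof.
rewrite /rank => /negPf ->; have := ord_lt p; have := ord_lt q.
by case: (low p) (high p) (high q) => [] [] [] hp hq e; apply: ord_inj; lia.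
Qed.

Lemma rank_gt0 p : (0 < rank p)%N -> ~~ low p.
Proof. by rewrite /rank; case: ifP. Qed.

Lemma rank_high p q : high p -> (rank p < rank q)%N -> high q.
Proof.
move=> hp; rewrite /rank hp (negPf (high_not_low hp)).
by have := ord_lt q; case: (low q); case: (high q) => //; lia.
Qed.

Lemma rank_ord p q : last p = last q -> (rank p < rank q)%N -> (ord p < ord q)%N.
Proof.
move=> pq h; have nq : ~~ low q by apply: rank_gt0; lia.
have [lp|nlp] := boolP (low p); first by rewrite /low in lp nq; lia.
have [hp|nhp] := boolP (high p).
  have hq := rank_high hp h.
  by move: h; rewrite /rank hp hq (negPf nlp) (negPf nq); lia.
have [/highP[k ek hk]|nhq] := boolP (high q); last first.
  by move: h; rewrite /rank (negPf nhp) (negPf nhq) (negPf nlp) (negPf nq); lia.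
apply: (ord_mono pq ek) => k' ek'; apply: leq_ltn_trans hk; rewrite leqNgt.
by apply: contra nhp => hk'; apply/highP; exists k'.
Qed.

(** All the openers that precede a closer [q] in rank lie on the same side of [q]
    on the line; this makes the nearest one unique. *)
Lemma rank_pos p q : (rank p < rank q)%N ->
  if last q then (pos q < pos p)%N else (pos p < pos q)%N.
Proof.
move=> h; have := @rank_ord p q; have := ord_lt q; have := ord_lt p.
by rewrite /pos; case: (last p); case: (last q) => hp hq // o;
  try (have := o erefl h); lia.
Qed.

Lemma alive_rank e : alive (inr e) ->
  [/\ (rank (opener e) < rank (closer e))%N, ~~ low (closer e) & ~~ high (opener e)].
Proof.
case: e => [[p q] /= pq]; rewrite /opener /closer /= => /andP[].
have pnq : p != q by apply: contraTneq pq => ->; rewrite ltnn.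
move=> nl nh; set a := if _ then p else q; set b := if _ then q else p.
have h : (rank a < rank b)%N.
  rewrite /a /b; case: (ltngtP (rank p) (rank q)) => [//|//|e]; case/negP: nl.
  have [lq|nq] := boolP (low q); last by case/eqP: pnq; apply: rank_inj nq e.
  rewrite andbT; have [//|np] := boolP (low p).
  by case/eqP: pnq; apply/esym/rank_inj.
split=> //; first by apply: rank_gt0; lia.
apply: contra nh => ha; have hb := rank_high ha h.
by move: ha hb; rewrite /a /b; case: ifP => _ -> ->.
Qed.

Definition opens v (u : letter) := match u with
  | inl v' => v' == v | inr e => va (opener e) == v end.
Definition closes q (u : letter) := if u is inr e then closer e == q else false.

Lemma letter_ends u u' p q : opens (va p) u -> closes q u -> opens (va p) u' -> closes q u' ->
  u = u'.
Proof.
case: u u' => [//|e] [//|e'] /= /eqP/va_inj op /eqP cl /eqP/va_inj op' /eqP cl'.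
congr inr; apply: val_inj; move: op cl op' cl'; rewrite /opener /closer.
case: e e' => [[a b] /= ab] [[c e] /= ce].
by case: ifP => _; case: ifP => _ ? ? ? ?; subst=> //; move: ab ce; lia.
Qed.

Lemma good_mem (w : seq letter) u u' : good bad w -> u \in w -> u' \in w -> u != u' -> ~~ bad u u'.
Proof.
move=> gw uw; rewrite (perm_mem (perm_to_rem uw)) inE eq_sym => h nu.
move: gw; rewrite (good_perm bad_sym (perm_to_rem uw)) good_cons => /andP[/allP gu _].
by apply: gu; case/orP: h => // /eqP e; rewrite e eqxx in nu.
Qed.

Lemma bad_crossing (e e' : chord) : crossing e e' || crossing e' e -> bad (inr e) (inr e').
Proof. by rewrite /bad /= => /orP[] ->; rewrite ?orbT. Qed.

Lemma ends_pos e p q : opener e = p -> closer e = q ->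
  pos (val e).1 = minn (pos p) (pos q) /\ pos (val e).2 = maxn (pos p) (pos q).
Proof.
case: e => [[a b] /= ab]; rewrite /opener /closer /=.
by case: ifP => _ <- <-; lia.
Qed.

Definition dist (a b : nat) := (a - b + (b - a))%N.

Lemma nearest_crossing (l l' : bool) (P P0 Q Q' : nat) :
  (if l then Q < P else P < Q)%N -> (if l then Q < P0 else P0 < Q)%N ->
  (if l' then Q' < Q else Q < Q')%N -> (if l' then Q' < P0 else P0 < Q')%N ->
  P != P0 -> (dist P Q <= dist P0 Q)%N ->
  [&& minn P0 Q < minn P Q', minn P Q' < maxn P0 Q & maxn P0 Q < maxn P Q']%N
  || [&& minn P Q' < minn P0 Q, minn P0 Q < maxn P Q' & maxn P Q' < maxn P0 Q]%N.
Proof. by rewrite /dist; case: l; case: l' => h1 h2 h3 h4 h5 h6; lia. Qed.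

(** The closer [q] of least rank is matched with the nearest available opener [p].
    Otherwise [p] belongs to another letter: a variable, which is then under the
    chord of [q], or a chord whose closer has larger rank, hence lies beyond [q]
    or beyond the other end, so that the two chords cross. *)
Lemma nearest_opener w p q : good bad w -> all alive w ->
  has (closes q) w -> (forall q', has (closes q') w -> rank q <= rank q')%N ->
  has (opens (va p)) w -> (rank p < rank q)%N ->
  (forall p', has (opens (va p')) w -> (rank p' < rank q)%N ->
     (dist (pos p) (pos q) <= dist (pos p') (pos q))%N) ->
  exists2 u, u \in w & opens (va p) u && closes q u.
Proof.
move=> gw aw /hasP[[//|e0] e0w /= /eqP cl0] minq /hasP[u uw ou] pq near.
have [r0 nl0 _] := alive_rank (allP aw _ e0w); rewrite cl0 in r0 nl0.
set p0 := opener e0 in r0.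
have [p0p|pp0] := eqVneq p p0.
  by exists (inr e0) => //=; rewrite p0p eqxx cl0 eqxx.
have hp0 : has (opens (va p0)) w by apply/hasP; exists (inr e0) => //=; apply: eqxx.
have [lo0 hi0] := ends_pos erefl cl0; rewrite -/p0 in lo0 hi0.
have near0 := near p0 hp0 r0.
have sp := rank_pos pq; have sp0 := rank_pos r0.
have np : pos p != pos p0 by apply: contra_neq pp0; apply: pos_inj.
case: u uw ou => [v vw /= /eqP ev|e ew /= /eqP/va_inj oe].
  (* a single variable under the chord [p0, q] *)
  have /negP[] := good_mem gw vw e0w isT; rewrite /bad /= ev orbF; apply/orP; left.
  apply/existsP; exists p; rewrite eqxx lo0 hi0.
  move: sp sp0 near0 np; rewrite /dist; move: (last q) (pos p) (pos p0) (pos q).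
  by clear=> -[] P P0 Q; lia.
have [_ nl1 _] := alive_rank (allP aw _ ew).
have [cl1|ncl] := eqVneq (closer e) q.
  by exists (inr e) => //=; rewrite oe eqxx cl1 eqxx.
have rq : (rank q < rank (closer e))%N.
  rewrite ltn_neqAle minq ?andbT; last by apply/hasP; exists (inr e) => //=; apply: eqxx.
  by apply: contra_neq ncl => /(rank_inj nl1) ->.
have /negP[] : ~~ bad (inr e0) (inr e).
  by apply: (good_mem gw) => //; apply: contra_neq ncl => - [<-].
apply: bad_crossing; rewrite /crossing lo0 hi0.
have [-> ->] := ends_pos oe erefl.
apply: (nearest_crossing sp sp0) np near0; first exact: rank_pos rq.
exact: rank_pos (ltn_trans r0 rq).
Qed.

(** The matching is forced one chord at a time: the chord found by
    [nearest_opener] depends only on the openers and closers, so it is in both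
    words and can be removed from both. *)
Lemma alive_words_perm w w' : good bad w -> good bad w' -> all alive w -> all alive w' ->
  (forall v, count (opens v) w = count (opens v) w') ->
  (forall q, count (closes q) w = count (closes q) w') -> perm_eq w w'.
Proof.
elim: {w}(size w) {-2}w (leqnn (size w)) w' => [|N IH] w sw w' gw gw' aw aw' ho hc.
  case: w sw ho hc gw aw => // _ ho hc _ _; case: w' ho hc {gw' aw'} => [//|[v|e] w'] ho hc.
    by have := ho v; rewrite /= eqxx.
  by have := hc (closer e); rewrite /= eqxx.
have [[q hq]|nq] := pselect (exists q, has (closes q) w); last first.
  have single (w0 : seq letter) : (forall q, count (closes q) w0 = 0%N) ->
      forall u, count_mem u w0 = if u is inl v then count (opens v) w0 else 0%N.
    move=> h0 u; case: u => [v|e].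
      apply: eq_in_count => -[v'|e'] uw //=.
      have := h0 (closer e'); move/eqP; rewrite -leqn0 leqNgt -has_count => /hasP[].
      by exists (inr e') => //=; apply: eqxx.
    apply/eqP; rewrite -leqn0 leqNgt -has_count; apply/hasP => -[u uw /eqP eu].
    have := h0 (closer e); move/eqP; rewrite -leqn0 leqNgt -has_count => /hasP[].
    by exists u => //; rewrite eu /=; apply: eqxx.
  have h0 q : count (closes q) w = 0%N.
    apply/eqP; rewrite -leqn0 leqNgt -has_count; apply/negP => h; by apply: nq; exists q.
  apply/allP => u _ /=; rewrite (single w h0) (single w'); last by move=> q; rewrite -hc.
  by case: u => // v; rewrite ho.
case: (@arg_minnP _ q (fun q => has (closes q) w) rank hq) => {hq}q hq minq.
have [[//|e0] e0w /= /eqP cl0] := hasP hq.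
have [r0 nl0 _] := alive_rank (allP aw _ e0w); rewrite cl0 in r0 nl0.
pose cand p := has (opens (va p)) w && (rank p < rank q)%N.
have c0 : cand (opener e0).
  by rewrite /cand r0 andbT; apply/hasP; exists (inr e0) => //=; apply: eqxx.
case: (@arg_minnP _ _ cand (fun p => dist (pos p) (pos q)) c0) => p.
case/andP => hp rp near.
have hc' s : has (closes s) w = has (closes s) w' by rewrite !has_count hc.
have ho' s : has (opens s) w = has (opens s) w' by rewrite !has_count ho.
have [u uw /andP[ou cu]] : exists2 u, u \in w & opens (va p) u && closes q u.
  by apply: nearest_opener => // p' hp' rp'; apply: near; rewrite /cand hp'.
have [u' uw' /andP[ou' cu']] : exists2 u, u \in w' & opens (va p) u && closes q u.
  apply: nearest_opener => //; [by rewrite -hc'|move=> q'|by rewrite -ho'|move=> p'].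
  - by rewrite -hc'; apply: minq.
  - by rewrite -ho' => hp' rp'; apply: near; rewrite /cand hp'.
rewrite -(letter_ends ou cu ou' cu') in uw'.
have pw := perm_to_rem uw; have pw' := perm_to_rem uw'.
rewrite (perm_trans pw) // perm_sym (perm_trans pw') // perm_sym perm_cons.
have cnt (a : pred letter) : count a w = count a w' -> count a (rem u w) = count a (rem u w').
  by rewrite (permP pw) (permP pw') /= => /addnI.
move: gw gw' aw aw'; rewrite (good_perm bad_sym pw) (good_perm bad_sym pw') !good_cons.
rewrite (perm_all _ pw) (perm_all _ pw') /= => /andP[_ g] /andP[_ g'] /andP[_ a] /andP[_ a'].
apply: IH => //; last by move=> s; apply: cnt.
  by rewrite size_rem //; case: (w) uw sw.
by move=> s; apply: cnt.
Qed.

End Leads.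

(** * Leading monomials *)

Section Weights.
Variable f : V -> nat.

Definition mweight (m : 'X_{1..#|V|}) := (\sum_v m (enum_rank v) * f v)%N.
Definition vmon (s : seq V) : 'X_{1..#|V|} := (\sum_(v <- s) U_(enum_rank v))%MM.
(** The gap [D] is added on the left so that strict bounds, [D = 1], multiply
    without subtraction. *)
Definition atmost (D B : nat) (P : {mpoly K[#|V|]}) :=
  forall m, m \in msupp P -> (mweight m + D <= B)%N.

Lemma mweightD m m' : mweight (m + m')%MM = (mweight m + mweight m')%N.
Proof. by rewrite /mweight -big_split; apply: eq_bigr => v _; rewrite mnmDE mulnDl. Qed.

Lemma vmonE s v : vmon s (enum_rank v) = count_mem v s.
Proof.
rewrite /vmon; elim: s => [|z s IH]; first by rewrite big_nil mnm0E.
by rewrite big_cons mnmDE IH mnm1E (inj_eq enum_rank_inj).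
Qed.

Lemma vmon_cat s s' : vmon (s ++ s') = (vmon s + vmon s')%MM.
Proof. by rewrite /vmon big_cat. Qed.

Lemma mweight_vmon s : mweight (vmon s) = (\sum_(v <- s) f v)%N.
Proof.
rewrite /vmon; elim: s => [|z s IH].
  by rewrite !big_nil /mweight big1 // => v _; rewrite mnm0E.
rewrite !big_cons mweightD IH; congr (_ + _)%N; rewrite /mweight (bigD1 z) //= mnm1E eqxx mul1n.
rewrite big1 ?addn0 // => v vz; rewrite mnm1E (inj_eq enum_rank_inj) eq_sym.
by rewrite (negPf vz).
Qed.

Lemma atmostX s : atmost 0 (\sum_(v <- s) f v) 'X_[vmon s].
Proof. by move=> m; rewrite msuppX inE => /eqP ->; rewrite addn0 mweight_vmon. Qed.

Lemma atmostW D B D' B' P : (D' + B <= D + B')%N -> atmost D B P -> atmost D' B' P.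
Proof. by move=> h hP m /hP; lia. Qed.

Lemma atmostD D B P Q : atmost D B P -> atmost D B Q -> atmost D B (P + Q).
Proof. by move=> hP hQ m /msuppD_le; rewrite mem_cat => /orP[/hP|/hQ]. Qed.

Lemma atmostN D B P : atmost D B P -> atmost D B (- P).
Proof. by move=> hP m; rewrite (perm_mem (msuppN _)); apply: hP. Qed.

Lemma atmostZ D B k P : atmost D B P -> atmost D B (k *: P).
Proof. by move=> hP m /msuppZ_le; apply: hP. Qed.

Lemma atmostM D B D' B' P Q : atmost D B P -> atmost D' B' Q ->
  atmost (D + D') (B + B') (P * Q).
Proof.
move=> hP hQ m /msuppM_le/allpairsP[[m1 m2] /= [/hP h1 /hQ h2 ->]].
by rewrite mweightD; lia.
Qed.

Definition leads (s : seq V) (P : {mpoly K[#|V|]}) := exists a Q,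
  [/\ a != 0, P = a *: 'X_[vmon s] + Q & atmost 1 (\sum_(v <- s) f v) Q].

Lemma leads_atmost s P : leads s P -> atmost 0 (\sum_(v <- s) f v) P.
Proof.
case=> a [Q [_ -> hQ]]; apply: atmostD; first exact/atmostZ/atmostX.
by apply: (atmostW _ hQ); lia.
Qed.

Lemma leads_coeff s P : leads s P -> P@_(vmon s) != 0.
Proof.
case=> a [Q [a0 -> hQ]]; rewrite mcoeffD mcoeffZ mcoeffX eqxx mulr1.
suff -> : Q@_(vmon s) = 0 by rewrite addr0.
apply/eqP; rewrite mcoeff_eq0; apply/negP => /hQ; rewrite mweight_vmon; lia.
Qed.

Lemma leadsN s P : leads s P -> leads s (- P).
Proof.
case=> a [Q [a0 -> hQ]]; exists (- a), (- Q); rewrite oppr_eq0 a0 opprD scaleNr.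
by split=> //; apply: atmostN.
Qed.

Lemma leadsM s P s' P' : leads s P -> leads s' P' -> leads (s ++ s') (P * P').
Proof.
move=> [a [Q [a0 eP hQ]]] [b [Q' [b0 eP' hQ']]].
have lP : leads s P by exists a, Q.
exists (a * b), (a *: 'X_[vmon s] * Q' + Q * P').
rewrite mulf_neq0 // vmon_cat mpolyXD; split=> //.
  by rewrite {1}eP mulrDl {1}eP' mulrDr addrA -!scalerAl -!scalerAr !scalerA.
rewrite big_cat /=; apply: atmostD.
  by apply: (@atmostM 0 _ 1) => //; apply/atmostZ/atmostX.
apply: (@atmostM 1 _ 0) => //; apply: leads_atmost; by exists b, Q'.
Qed.

End Weights.

Definition xv v : {mpoly K[#|V|]} := 'X_(enum_rank v).
Definition cross p q := xv (va p) * xv (vb q) - xv (va q) * xv (vb p).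
Definition lpoly (u : letter) := match u with
  | inl v => xv v
  | inr e => cross (val e).1 (val e).2 end.

Lemma xvE v : xv v = 'X_[vmon [:: v]].
Proof. by rewrite /xv /vmon big_seq1. Qed.

Lemma xv2E v v' : xv v * xv v' = 'X_[vmon [:: v; v']].
Proof. by rewrite !xvE -mpolyXD -vmon_cat. Qed.

(** The weight on the variables: [om] is [Phi] with its last step capped at [theta],
    and [psi], scaled below it by [S], makes the monomial with the right closer
    win between two monomials of the same [om]. *)
Section LetterLeads.
Variables (theta S : nat).

Definition om v := if [pick k | vb k == v] is Some k
  then (Phi (va k) + minn (ord k) theta)%N else 0%N.
Definition psi v := if [pick k | vb k == v] is Some k
  then (if theta < ord k then rank theta k else 0)%N else 0%N.
Definition om_psi v := (S * om v + psi v)%N.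
(** Bounds the contribution of [psi] to any monomial of a letter. *)
Definition excess := (4 * ord_bound)%N.
Definition is_chord (u : letter) := if u is inr _ then true else false.
(** The largest value of [om] that a monomial of the letter can reach. *)
Definition top u := (height u + is_chord u * theta)%N.
Definition lead_vars (u : letter) := match u with
  | inl v => [:: v]
  | inr e => [:: va (opener theta e); vb (closer theta e)] end.

Lemma pick_vb k : [pick j | vb j == vb k] = Some k.
Proof. by case: pickP => [j /eqP/vb_inj -> //|/(_ k)]; rewrite eqxx. Qed.

Lemma om_vb k : om (vb k) = (Phi (va k) + minn (ord k) theta)%N.
Proof. by rewrite /om pick_vb. Qed.

Lemma om_dead v : dead theta v -> (om v < Phi v)%N.
Proof. by case/existsP => k /andP[/eqP <- h]; rewrite om_vb Phi_step; lia. Qed.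

Lemma om_live v : ~~ dead theta v -> om v = Phi v.
Proof.
move=> nd; rewrite /om; case: pickP => [k /eqP e|h'].
  rewrite -e Phi_step; congr addn; apply/minn_idPl; rewrite leqNgt; apply/negP => hk.
  by case/existsP: nd; exists k; rewrite e eqxx.
by rewrite Phi_first // => k e; have := h' k; rewrite e eqxx.
Qed.

Lemma om_le v : (om v <= Phi v)%N.
Proof. by case: (boolP (dead theta v)) => [/om_dead/ltnW|/om_live ->]. Qed.

Lemma rank_le p : (rank theta p <= 2 * ord_bound)%N.
Proof. by have := ord_lt p; rewrite /rank; case: ifP => _ //; case: ifP => _; lia. Qed.

Lemma psi_le v : (psi v <= 2 * ord_bound)%N.
Proof. by rewrite /psi; case: pickP => // k _; case: ifP => // _; apply: rank_le. Qed.

Lemma psi_vb k : psi (vb k) = (if theta < ord k then rank theta k else 0)%N.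
Proof. by rewrite /psi pick_vb. Qed.

Lemma psi_va p : ~~ high theta p -> psi (va p) = 0%N.
Proof.
move=> hp; rewrite /psi; case: pickP => // k /eqP e; case: ifP => // hk.
by case/negP: hp; apply/highP; exists k.
Qed.

Lemma om_closer q : (om (vb q) <= Phi (va q) + theta)%N.
Proof. by rewrite om_vb; lia. Qed.

Lemma om_closer_low q : low theta q -> (om (vb q) < Phi (va q) + theta)%N.
Proof. by rewrite om_vb /low; lia. Qed.

Lemma om_closer_live q : ~~ low theta q -> om (vb q) = (Phi (va q) + theta)%N.
Proof. by rewrite om_vb /low; lia. Qed.

Lemma lpoly_atmost u : atmost om_psi 0 (S * top u + excess) (lpoly u).
Proof.
case: u => [v|[[p q] /= pq]]; rewrite /excess /top /=.
  rewrite xvE; apply: (atmostW _ (@atmostX _ _)); rewrite big_seq1 /om_psi.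
  by have := om_le v; have := psi_le v; nia.
have aux a b : atmost om_psi 0
    (S * (Phi (va a) + Phi (va b) + 1 * theta) + 4 * ord_bound) (xv (va a) * xv (vb b)).
  rewrite xv2E; apply: (atmostW _ (@atmostX _ _)); rewrite !big_cons big_nil /om_psi.
  have := om_le (va a); have := psi_le (va a); have := psi_le (vb b).
  by have := om_closer b; nia.
by apply: atmostD; [apply: aux|apply: atmostN; rewrite [in (Phi _ + _)%N]addnC; apply: aux].
Qed.

Lemma lpoly_dead u : ~~ alive theta u -> atmost om_psi S (S * top u + excess) (lpoly u).
Proof.
case: u => [v|[[p q] /= pq]]; rewrite /excess /top /=.
  rewrite negbK xvE => dv; apply: (atmostW _ (@atmostX _ _)); rewrite big_seq1 /om_psi.
  by have := om_dead dv; have := psi_le v; nia.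
have aux a b : low theta b || high theta a -> atmost om_psi S
    (S * (Phi (va a) + Phi (va b) + 1 * theta) + 4 * ord_bound) (xv (va a) * xv (vb b)).
  move=> h; rewrite xv2E; apply: (atmostW _ (@atmostX _ _)); rewrite !big_cons big_nil /om_psi.
  have := psi_le (va a); have := psi_le (vb b); have := om_le (va a); have := om_closer b.
  by case/orP: h => [/om_closer_low|/om_dead]; nia.
move=> h; apply: atmostD; last apply: atmostN; last rewrite [in (Phi _ + _)%N]addnC.
  by apply: aux; move: h; do 4 case: (_ theta _).
by apply: aux; move: h; do 4 case: (_ theta _).
Qed.

Hypothesis S_big : (excess < S)%N.

(** The two monomials of a minor are [va p * vb q] and [va q * vb p].  The first
    reaches the cap exactly when [p] is not high and [q] is not low.  When both
    reach it, [psi] vanishes on the top entries and the closer of larger rank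
    decides. *)
Lemma lpoly_leads u : alive theta u -> leads om_psi (lead_vars u) (lpoly u) /\
  (S * top u <= \sum_(v <- lead_vars u) om_psi v)%N.
Proof.
case: u => [v /= nd|e ae].
  split; last first.
    by rewrite big_seq1 /top /om_psi /=; rewrite om_live //; lia.
  exists 1, 0; rewrite oner_neq0 xvE scale1r addr0; split=> //.
  by move=> m; rewrite msupp0.
have [r0 nl nh] := alive_rank ae.
have et : top (inr e) = (Phi (va (opener theta e)) + Phi (va (closer theta e)) + theta)%N.
  by rewrite /top /= mul1n /opener /closer; case: ifP => // _; rewrite [in RHS](addnC (Phi _)).
have key : leads om_psi (lead_vars (inr e)) (cross (opener theta e) (closer theta e)).
  rewrite /=; move: (opener theta e) (closer theta e) r0 nl nh {et} => p q r0 nl nh.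
  exists 1, (- (xv (va q) * xv (vb p))); rewrite oner_neq0 scale1r /cross [xv (va p) * _]xv2E.
  split=> //; apply: atmostN; rewrite xv2E; apply: (atmostW _ (@atmostX _ _)).
  rewrite !big_cons !big_nil /om_psi (om_closer_live nl) (om_live nh) (psi_va nh).
  have := om_closer p; have := om_le (va q); have := psi_le (va q); have := psi_le (vb p).
  (* the other monomial has the roles of the two ends exchanged *)
  have [lp|np] := boolP (low theta p).
    by have := om_closer_low lp; move: S_big; rewrite /excess; nia.
  have [hq|nq] := boolP (high theta q).
    by have := om_dead hq; move: S_big; rewrite /excess; nia.
  rewrite (psi_va nq) !psi_vb.
  have -> : (theta < ord q)%N.
    move: r0; rewrite /rank (negPf nl) (negPf np) (negPf nq) (negPf nh).
    by move: np; rewrite /low; lia.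
  by case: ifP => _; nia.
split.
  move: key => /=; rewrite /opener /closer; case: ifP => // _ key.
  suff -> : cross (val e).1 (val e).2 = - cross (val e).2 (val e).1 by apply: leadsN.
  by rewrite /cross opprB.
rewrite et /= !big_cons big_nil /om_psi.
by rewrite om_closer_live // (om_live nh); nia.
Qed.

End LetterLeads.

Definition wpoly (w : seq letter) := \prod_(u <- w) lpoly u.

Section WordLeads.
Variables (theta S : nat).

Definition wtop (w : seq letter) := (\sum_(u <- w) top theta u)%N.
Definition wlead (w : seq letter) := flatten [seq lead_vars theta u | u <- w].

Lemma wtopE w : wtop w = (\sum_(u <- w) height u + count is_chord w * theta)%N.
Proof.
rewrite /wtop; elim: w => [|u w IH]; first by rewrite !big_nil.
by rewrite !big_cons IH /top /= mulnDl -!addnA; congr addn; rewrite addnCA.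
Qed.

Lemma wpoly_atmost w :
  atmost (om_psi theta S) 0 (S * wtop w + size w * excess) (wpoly w).
Proof.
rewrite /wtop /wpoly; elim: w => [|u w IH].
  rewrite big_nil big_nil => m; rewrite msupp1 inE => /eqP ->.
  by rewrite /mweight big1 // => v _; rewrite mnm0E.
rewrite !big_cons; apply: (atmostW _ (atmostM (@lpoly_atmost theta S u) IH)).
by rewrite /= mulnDr mulSn; lia.
Qed.

Lemma wpoly_dead w : ~~ all (alive theta) w ->
  atmost (om_psi theta S) S (S * wtop w + size w * excess) (wpoly w).
Proof.
rewrite /wtop /wpoly; elim: w => [//|u w IH] /=; rewrite negb_and => /orP[du|/IH{}IH].
  rewrite !big_cons; apply: (atmostW _ (atmostM (@lpoly_dead theta S u du) (@wpoly_atmost w))).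
  by rewrite /wtop /= mulnDr mulSn; lia.
rewrite !big_cons; apply: (atmostW _ (atmostM (@lpoly_atmost theta S u) IH)).
by rewrite /= mulnDr mulSn; lia.
Qed.

Hypothesis S_big : (excess < S)%N.

Lemma wpoly_leads w : all (alive theta) w -> leads (om_psi theta S) (wlead w) (wpoly w) /\
  (S * wtop w <= \sum_(v <- wlead w) om_psi theta S v)%N.
Proof.
rewrite /wtop /wpoly /wlead; elim: w => [_|u w IH /= /andP[au /IH[lw bw]]].
  rewrite !big_nil muln0; split=> //; exists 1, 0.
  rewrite oner_neq0 scale1r addr0 /vmon big_nil mpolyX0; split=> // m.
  by rewrite msupp0.
have [lu bu] := lpoly_leads S_big au.
rewrite !big_cons big_cat /= mulnDr; split; [exact: leadsM | exact: leq_add].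
Qed.

End WordLeads.

Lemma count_lead_closer theta w q : all (alive theta) w -> (theta < ord q)%N ->
  count (closes theta q) w = count_mem (vb q) (wlead theta w).
Proof.
move=> aw hq; rewrite /wlead; elim: w aw => [//|u w IH /= /andP[au aw]].
rewrite count_cat IH //; congr (_ + _)%N; case: u au => [v /= nd|e ae].
  rewrite addn0; case: eqP => // ev; case/negP: nd; apply/existsP; exists q.
  by rewrite ev eqxx.
have [_ _ nh] := alive_rank ae; rewrite /= addn0 (inj_eq vb_inj).
case: (va (opener theta e) =P vb q) => // ev; case/negP: nh; apply/highP.
by exists q.
Qed.

Lemma count_lead theta w v :
  count_mem v (wlead theta w) = (count (opens theta v) w +
    if [pick q | vb q == v] is Some q then count (closes theta q) w else 0)%N.
Proof.
rewrite /wlead; elim: w => [|u w IH /=]; first by case: pickP.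
rewrite count_cat IH; case: u => [v'|e] /=; case: pickP => [q /eqP eq|nq] /=.
- by lia.
- by lia.
- by rewrite -eq (inj_eq vb_inj); lia.
- by rewrite nq; lia.
Qed.

Lemma closes_low theta w q : all (alive theta) w -> (ord q < theta)%N ->
  count (closes theta q) w = 0%N.
Proof.
move=> aw lq; apply/eqP; rewrite -leqn0 leqNgt -has_count; apply/hasP.
case=> -[//|e] ew /= /eqP eq; have [_ nl _] := alive_rank (allP aw _ ew).
by rewrite eq /low lq in nl.
Qed.

(** Provides the number of chords closing at the column of order exactly [theta],
    which the exponents do not separate from a variable. *)
Lemma sum_closes theta (w : seq letter) : (\sum_q count (closes theta q) w = count is_chord w)%N.
Proof.
elim: w => [|u w IH]; first by rewrite big1.
rewrite /= big_split /= IH; congr (_ + _)%N; case: u => [v|e] /=; first by rewrite big1.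
by rewrite (bigD1 (closer theta e)) //= eqxx big1 // => q; rewrite eq_sym => /negPf ->.
Qed.

Lemma alive_words_lead theta w w' : good bad w -> good bad w' ->
  all (alive theta) w -> all (alive theta) w' -> count is_chord w = count is_chord w' ->
  vmon (wlead theta w) = vmon (wlead theta w') -> perm_eq w w'.
Proof.
move=> gw gw' aw aw' ek el.
have cv v : count_mem v (wlead theta w) = count_mem v (wlead theta w') by rewrite -!vmonE el.
have cne q : ord q != theta -> count (closes theta q) w = count (closes theta q) w'.
  rewrite neq_ltn => /orP[h|h]; first by rewrite !closes_low.
  by rewrite !count_lead_closer // cv.
have cq q : count (closes theta q) w = count (closes theta q) w'.
  have [e|/cne //] := eqVneq (ord q) theta.
  move: ek; rewrite -(sum_closes theta w) -(sum_closes theta w') (bigD1 q) //= [in RHS](bigD1 q) //=.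
  rewrite [in RHS](eq_bigr (fun p => count (closes theta p) w)) => [/addIn //|p pq].
  by apply/esym/cne; apply: contra_neq pq; rewrite -e; apply: ord_inj.
apply: (alive_words_perm gw gw' aw aw') => // v.
move: (cv v); rewrite !count_lead; case: pickP => [q _|_]; last by rewrite !addn0.
by rewrite cq => /addIn.
Qed.

(** The threshold is the least, over the chords of the word, of the later end, so
    no chord has two low ends.  A dead variable or a chord with two high ends
    would be bad together with the chord that attains this minimum. *)
Lemma std_alive w : std bad w -> exists theta, all (alive theta) w.
Proof.
case/andP=> _ gw.
pose ends (e : chord) := maxn (ord (val e).1) (ord (val e).2).
have [[e0 e0w]|nw] := pselect (exists e, inr e \in w); last first.
  exists ord_bound; apply/allP => -[v vw|e ew]; last by case: nw; exists e.
  apply/existsP => -[k /andP[_]]; by have := ord_lt k; lia.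
case: (@arg_minnP _ e0 (fun e => inr e \in w) ends e0w) => e ew emin.
exists (ends e); apply/allP => -[v vw /=|e' ew' /=].
  apply/existsP => -[k /andP[ek hk]]; have /negP[] := good_mem gw vw ew isT.
  rewrite /bad /= orbF; apply/orP; right; apply/existsP; exists k.
  by move: hk; rewrite ek /ends /= gtn_max.
apply/andP; split.
  by rewrite /low -gtn_max -leqNgt; apply: emin.
apply/andP => -[/highP[k ek hk] /highP[l el hl]].
have ne : inr e != inr e' :> letter.
  apply: contraTneq hk => -[ee]; move: ek; rewrite -ee => /ord_step h.
  by rewrite -leqNgt /ends leq_max ltnW.
have /negP[] := good_mem gw ew ew' ne.
rewrite /bad /=; apply/orP; left; apply/orP; right.
apply/existsP; exists k; apply/existsP; exists l; rewrite ek el !eqxx.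
by move: hk hl; rewrite /ends /= !gtn_max => /andP[-> ->] /andP[-> ->].
Qed.

(** The words in the relation are compared by height first.  Those of smaller
    height, and dead ones of maximal height, have only monomials of smaller
    weight, because [S] exceeds the total excess of a word; among the remaining
    ones the leading monomials are distinct. *)
Lemma words_free n k (c : n.-tuple letter -> K) :
  (forall w, c w != 0 -> std bad w /\ count is_chord w = k) ->
  \sum_w c w *: wpoly w = 0 -> forall w, c w = 0.
Proof.
move=> hc rel w; apply/eqP/negPn/negP => cw.
pose ht (w : n.-tuple letter) := (\sum_(u <- w) height u)%N.
case: (@arg_maxnP _ w (fun w => c w != 0) ht cw) => w0 cw0 max0 {w cw}.
have [theta al0] := std_alive (hc _ cw0).1.
have [S Sb Sn] : exists2 S, (excess < S)%N & (n * excess < S)%N.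
  by exists (n * excess + excess).+1; lia.
pose lw (w : n.-tuple letter) := (\sum_(v <- wlead theta w) om_psi theta S v)%N.
pose cand (w : n.-tuple letter) := [&& c w != 0, ht w == ht w0 & all (alive theta) w].
have c0 : cand w0 by rewrite /cand cw0 eqxx.
case: (@arg_maxnP _ w0 cand lw c0) => w1 /and3P[cw1 /eqP h1 al1] max1.
have [l1 b1] := wpoly_leads Sb al1.
have := congr1 (mcoeff (vmon (wlead theta w1))) rel.
rewrite raddf_sum /= mcoeff0 (bigD1 w1) //= big1 => [|w ww1].
  rewrite addr0 mcoeffZ => /eqP; rewrite mulf_eq0 (negPf cw1) /=.
  by rewrite (negPf (leads_coeff l1)).
rewrite mcoeffZ; have [->|cw] := eqVneq (c w) 0; first by rewrite mul0r.
have tw : wtop theta w = (ht w + k * theta)%N by rewrite wtopE (hc _ cw).2.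
have tw1 : wtop theta w1 = (ht w0 + k * theta)%N by rewrite wtopE (hc _ cw1).2 -h1.
suff -> : (wpoly w)@_(vmon (wlead theta w1)) = 0 by rewrite mulr0.
apply/eqP; rewrite mcoeff_eq0; apply/negP => hm.
have mw := @mweight_vmon (om_psi theta S) (wlead theta w1).
have [aw|dw] := boolP (all (alive theta) w); last first.
  have := @wpoly_dead theta S w dw _ hm; rewrite mw size_tuple.
  have tt1 : (S * wtop theta w <= S * wtop theta w1)%N.
    by rewrite tw tw1 leq_mul2l leq_add2r; apply/orP; right; apply: max0.
  by move: b1 tt1 Sn; clear; lia.
have [hw|nhw] := eqVneq (ht w) (ht w0); last first.
  have := @wpoly_atmost theta S w _ hm; rewrite mw size_tuple.
  have tt1 : (S * (wtop theta w).+1 <= S * wtop theta w1)%N.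
    by rewrite tw tw1 leq_mul2l -addSn leq_add2r ltn_neqAle nhw; apply/orP; right; apply: max0.
  by move: b1 tt1 Sn; clear; rewrite mulnS; lia.
have [lw' _] := wpoly_leads Sb aw.
have [e|ne] := eqVneq (vmon (wlead theta w)) (vmon (wlead theta w1)).
  case/eqP: ww1; apply: val_inj; have [/andP[s g] k1] := hc _ cw.
  have [/andP[s1 g1] k2] := hc _ cw1.
  apply: (sorted_eq (@rk_trans _) (@rk_anti _) s s1).
  by apply: (alive_words_lead g g1 aw al1) => //; rewrite k1 k2.
have [a [Q [_ eP hQ]]] := lw'.
move: hm; rewrite eP => /msuppD_le; rewrite mem_cat => /orP[/msuppZ_le|/hQ].
  by rewrite msuppX inE eq_sym (negPf ne).
rewrite mw; have := max1 w; rewrite /cand cw hw eqxx aw /lw /= => /(_ isT); clear; lia.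
Qed.

(** * The Rees ring of a staircase *)

Section ReesRing.
Variable I : {mpoly K[#|V|]} -> Prop.
Hypothesis I_cross : forall r, I r <->
  exists a : C -> C -> {mpoly K[#|V|]}, r = \sum_p \sum_q a p q * cross p q.
Local Notation R := {mpoly K[#|V|]}.
Local Notation A := (rees I).
Local Notation gr := (@rees_gr K #|V| I).

Lemma cross_in p q : I (cross p q).
Proof.
apply/I_cross; exists (fun p' q' => if (p' == p) && (q' == q) then 1 else 0).
rewrite (bigD1 p) //= (bigD1 q) //= !eqxx mul1r big1 => [|q' /negPf h]; last first.
  by rewrite h mul0r.
rewrite addr0 big1 ?addr0 // => p' /negPf h.
by rewrite big1 // => q' _; rewrite h mul0r.
Qed.

Definition cst (r : R) : A := Rees (introT (asboolP _) (in_rees_C I r)).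
Definition lin (r : R) (Ir : I r) : A := Rees (introT (asboolP _) (in_rees_t Ir)).
Definition ry v : A := cst (xv v).
Definition rE p q : A := lin (cross_in p q).
Definition rx : letter -> A := x ry rE.

Lemma rE0 p : rE p p = 0.
Proof. by apply: val_inj; rewrite /= /cross subrr scale0r. Qed.

Lemma rEN p q : rE q p = - rE p q.
Proof. by apply: val_inj; rewrite /= -scaleNr /cross opprB. Qed.

Lemma rE_plucker a b c e : rE a c * rE b e = rE a b * rE c e + rE a e * rE b c.
Proof.
apply: val_inj; rewrite /= -!scalerAl -!scalerAr !scalerA -scalerDl; congr (_ *: _).
by rewrite /cross; ring.
Qed.

Lemma rE_va p q r : ry (va r) * rE p q = ry (va p) * rE r q + ry (va q) * rE p r.
Proof.
apply: val_inj; rewrite /= !mul_polyC !scalerA -scalerDl; congr (_ *: _).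
by rewrite /cross; ring.
Qed.

Lemma rE_vb p q r : ry (vb r) * rE p q = ry (vb p) * rE r q + ry (vb q) * rE p r.
Proof.
apply: val_inj; rewrite /= !mul_polyC !scalerA -scalerDl; congr (_ *: _).
by rewrite /cross; ring.
Qed.

Lemma rE_shift i j k l i' j' k' l' :
  va i' = vb i -> va j' = vb j -> va k' = vb k -> va l' = vb l ->
  rE i j * rE k' l' = rE i k * rE j' l' - rE i l * rE j' k' - rE j k * rE i' l'
                  + rE j l * rE i' k' - rE k l * rE i' j'.
Proof.
move=> ei ej ek el; apply: val_inj.
rewrite /= -!scalerAl -!scalerAr !scalerA -!scalerBl -scalerDl -scalerBl.
by congr (_ *: _); rewrite /cross ei ej ek el; ring.
Qed.

Lemma val_rx u : val (rx u) = lpoly u *: 'X^(is_chord u).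
Proof. by case: u => [v|e] //=; rewrite expr0 alg_polyC. Qed.

Lemma val_mon w : val (mon rx w) = wpoly w *: 'X^(count is_chord w).
Proof.
rewrite /mon /wpoly; elim: w => [|u w IH].
  by rewrite !big_nil expr0 scale1r.
rewrite !big_cons rmorphM /= IH val_rx /= exprD.
by rewrite -scalerAl -scalerAr scalerA.
Qed.

Lemma val_scale c (f : A) k : (val (c *: f))`_k = c *: (val f)`_k.
Proof. by rewrite /= coefCM mul_mpolyC. Qed.

(** The coefficient of [t^k] selects the words with [k] chords. *)
Lemma rx_free n (c : n.-tuple letter -> K) : (forall w, c w != 0 -> std bad w) ->
  \sum_w c w *: mon rx w = 0 -> forall w, c w = 0.
Proof.
move=> hc rel w; apply/eqP/negPn/negP => cw; pose k := count is_chord w.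
pose c' (w : n.-tuple letter) := if count is_chord w == k then c w else 0.
suff : c' w = 0 by rewrite /c' eqxx => e; rewrite e eqxx in cw.
apply: (@words_free n k c') => [v|].
  by rewrite /c'; case: ifP => [/eqP ev cv|_]; [split; first exact: hc | rewrite eqxx].
have := congr1 (fun f : A => (val f)`_k) rel; rewrite raddf_sum coef_sum coef0; apply: etrans.
apply: eq_bigr => v _; rewrite val_scale val_mon coefZ coefXn eq_sym /c'.
by case: eqP => _; rewrite ?mulr1 // scale0r mulr0 scaler0.
Qed.

Lemma grP n (f : A) : gr n f <->
  forall k m, m \in msupp (val f)`_k -> mdeg m = (n + k)%N.
Proof. by split=> h k m /h; lia. Qed.

Lemma gr0 n : gr n 0.
Proof. by move=> k m; rewrite coef0 msupp0. Qed.

Lemma grD n a b : gr n a -> gr n b -> gr n (a + b).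
Proof.
move=> ha hb k m; rewrite /= coefD => /msuppD_le; rewrite mem_cat.
by case/orP=> [/ha|/hb].
Qed.

Lemma grZ n c a : gr n a -> gr n (c *: a).
Proof. by move=> ha k m; rewrite val_scale => /msuppZ_le /ha. Qed.

Lemma gr_sum n (T : Type) (s : seq T) (P : pred T) (F : T -> A) :
  (forall i, P i -> gr n (F i)) -> gr n (\sum_(i <- s | P i) F i).
Proof. by move=> h; elim/big_rec: _ => [|i a Pi ha]; [apply: gr0 | apply: grD => //; apply: h]. Qed.

Lemma grM m n a b : gr m a -> gr n b -> gr (m + n) (a * b).
Proof.
move=> /grP ha /grP hb; apply/grP => k mm; rewrite /= coefM => /msupp_sum_le.
case/flatten_mapP => i _ /msuppM_le/allpairsP[[m1 m2] /= [/ha h1 /hb h2 ->]].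
by rewrite mdegD h1 h2; have := ltn_ord i; lia.
Qed.

Lemma gr_directP n (f : nat -> A) : (forall i, gr i (f i)) ->
  \sum_(i < n) f i = 0 -> forall i, (i < n)%N -> f i = 0.
Proof.
move=> hf s0 i ni; apply: val_inj; apply/polyP => k; apply/mpolyP => m.
rewrite coef0 mcoeff0; apply/eqP; rewrite mcoeff_eq0; apply/negP => hm.
have := congr1 (fun a : A => ((val a)`_k)@_m) s0.
rewrite raddf_sum coef_sum raddf_sum /= coef0 mcoeff0 (bigD1 (Ordinal ni)) //= big1.
  by rewrite addr0 => /eqP; rewrite mcoeff_eq0 hm.
move=> j ji; apply/eqP; rewrite mcoeff_eq0; apply: contra ji => hj.
have /grP h1 := hf i; have /grP h2 := hf j.
by apply/eqP/val_inj => /=; have := h1 _ _ hm; have := h2 _ _ hj; lia.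
Qed.

Lemma rx_gr u : gr 1 (rx u).
Proof.
apply/grP => k m; rewrite val_rx coefZ coefXn.
have [->|_] := eqVneq k (is_chord u); last by rewrite mulr0 msupp0.
rewrite mulr1; case: u => [v|e] /=; first by rewrite /xv msuppX inE => /eqP ->; rewrite mdeg1.
have two v v' m' : m' \in msupp (xv v * xv v') -> mdeg m' = (1 + 1)%N.
  by rewrite /xv -mpolyXD msuppX inE => /eqP ->; rewrite mdegD !mdeg1.
by rewrite /cross => /msuppB_le; rewrite mem_cat => /orP[/two|/two].
Qed.

Lemma word_gr w : gr (size w) (mon rx w).
Proof.
rewrite /mon; elim: w => [|u w IH]; last by rewrite big_cons /= -add1n; apply: grM => //; apply: rx_gr.
rewrite big_nil; apply/grP => -[|k] m; rewrite /= coef1 ?msupp0 //= msupp1 inE => /eqP ->.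
by rewrite mdeg0.
Qed.

Definition spanned (a : A) := exists s : seq (K * seq letter),
  a = \sum_(p <- s) p.1 *: mon rx p.2.

Lemma spanned_word w : spanned (mon rx w).
Proof. by exists [:: (1, w)]; rewrite big_seq1 scale1r. Qed.

Lemma spannedD a b : spanned a -> spanned b -> spanned (a + b).
Proof. by move=> [s ->] [t ->]; exists (s ++ t); rewrite big_cat. Qed.

Lemma spannedZ c a : spanned a -> spanned (c *: a).
Proof.
move=> [s ->]; exists [seq (c * p.1, p.2) | p <- s]; rewrite big_map scaler_sumr.
by apply: eq_bigr => p _; rewrite scalerA.
Qed.

Lemma spanned_sum (T : Type) (s : seq T) (F : T -> A) :
  (forall i, spanned (F i)) -> spanned (\sum_(i <- s) F i).
Proof.
move=> h; elim/big_rec: _ => [|i a _]; last exact: spannedD.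
by exists [::]; rewrite big_nil.
Qed.

Lemma spannedM a b : spanned a -> spanned b -> spanned (a * b).
Proof.
move=> [s ->] [t ->]; rewrite mulr_suml; apply: spanned_sum => p.
rewrite mulr_sumr; apply: spanned_sum => q.
rewrite -scalerAl -scalerAr; do 2 apply: spannedZ.
by rewrite -mon_cat; apply: spanned_word.
Qed.

Lemma spanned_letter u : spanned (rx u).
Proof. by have := spanned_word [:: u]; rewrite /mon big_seq1. Qed.

Lemma spanned_rE p q : spanned (rE p q).
Proof.
have [->|pq] := eqVneq p q; first by rewrite rE0; exists [::]; rewrite big_nil.
have [e [[->|->] _ _]] := E_letter ry rEN pq; first exact: (spanned_letter (inr e)).
by rewrite -scaleN1r; apply: spannedZ; apply: (spanned_letter (inr e)).
Qed.

Lemma cst_is_additive : additive cst.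
Proof. by move=> a b; apply: val_inj; rewrite /= polyCB. Qed.
HB.instance Definition _ := GRing.isAdditive.Build R A cst cst_is_additive.
Lemma cst_is_multiplicative : multiplicative cst.
Proof. by split=> [a b|]; apply: val_inj; rewrite //= polyCM. Qed.
HB.instance Definition _ := GRing.isMultiplicative.Build R A cst cst_is_multiplicative.

Lemma spanned_cst r : spanned (cst r).
Proof.
rewrite [r]mpolyE raddf_sum; apply: spanned_sum => m; rewrite /=.
have -> : cst (r@_m *: 'X_[m]) = r@_m *: cst 'X_[m].
  by apply: val_inj; rewrite /= -mul_mpolyC polyCM.
apply: spannedZ; rewrite mpolyXE_id rmorph_prod; elim/big_rec: _ => [|i a _ ha].
  by have := spanned_word [::]; rewrite /mon big_nil.
apply: spannedM => //; rewrite rmorphXn; elim: (m i) => [|k IH].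
  by have := spanned_word [::]; rewrite /mon big_nil.
rewrite exprS; apply: spannedM => //.
by have := spanned_letter (inl (enum_val i)); rewrite /= /ry /xv enum_valK.
Qed.

(** The constructors of [in_rees] are sums, products, constants, which are
    polynomials in the variables, and [r t] with [r] a combination of minors. *)
Lemma spanned_all a : spanned a.
Proof.
suff key g : in_rees I g -> exists2 b : A, val b = g & spanned b.
  have [b eb hb] := key _ (asboolP _ (valP a)); suff <- : b = a by [].
  exact: val_inj.
elim=> [r|r|f f' _ [b <- hb] _ [b' <- hb']|f f' _ [b <- hb] _ [b' <- hb']].
- by exists (cst r) => //; apply: spanned_cst.
- case/I_cross=> c ->; exists (\sum_p \sum_q cst (c p q) * rE p q).
    rewrite raddf_sum scaler_suml; apply: eq_bigr => p _.
    rewrite raddf_sum scaler_suml; apply: eq_bigr => q _.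
    by rewrite /= mul_polyC scalerA.
  do 2 apply: spanned_sum => ?; apply: spannedM; first exact: spanned_cst.
  exact: spanned_rE.
- by exists (b + b') => //; apply: spannedD.
- by exists (b * b') => //; apply: spannedM.
Qed.

Lemma homogeneous_parts (s : seq (K * seq letter)) : exists N, forall M, (N <= M)%N ->
  \sum_(p <- s) p.1 *: mon rx p.2 =
  \sum_(i < M) \sum_(p <- s | size p.2 == i) p.1 *: mon rx p.2.
Proof.
exists (\max_(p <- s) size p.2).+1 => M hM; rewrite (exchange_big_dep xpredT) //=.
rewrite big_seq [RHS]big_seq; apply: eq_bigr => p ps.
have pM : (size p.2 < M)%N.
  by apply: leq_trans hM; rewrite ltnS; apply: (@leq_bigmax_seq _ _ _ (fun p => size p.2)).
by rewrite (big_pred1 (Ordinal pM)).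
Qed.

Lemma parts_gr (s : seq (K * seq letter)) i :
  gr i (\sum_(p <- s | size p.2 == i) p.1 *: mon rx p.2).
Proof. by apply: gr_sum => p /eqP <-; apply/grZ/word_gr. Qed.

Lemma rx_span n a : gr n a -> lc (fun _ : n.-tuple letter => True) (fun w => mon rx w) a.
Proof.
move=> ha; have [s es] := spanned_all a.
pose h i := \sum_(p <- s | size p.2 == i) p.1 *: mon rx p.2.
suff -> : a = h n.
  apply: lc_sum => p /eqP sp; apply: lcZ.
  pose w := Tuple (introT eqP sp); rewrite -[p.2]/(tval w).
  exact: (@lc_gen _ _ _ _ (fun w : n.-tuple letter => mon rx w)).
have [N hN] := homogeneous_parts s.
have hf i : gr i (h i - (if i == n then a else 0)).
  apply: grD; first exact: parts_gr.
  rewrite -scaleN1r; apply: grZ; case: eqP => [->//|_]; exact: gr0.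
have s0 : \sum_(i < N + n.+1) (h i - (if (i : nat) == n then a else 0)) = 0.
  rewrite sumrB -hN ?leq_addr // -es -big_mkcond /=.
  have nN : (n < N + n.+1)%N by lia.
  by rewrite (big_pred1 (Ordinal nN)) // subrr.
have := gr_directP hf s0 (_ : n < N + n.+1)%N; rewrite eqxx => e.
by apply/esym/eqP; rewrite -subr_eq0 e //; lia.
Qed.

Lemma mon_thead n (w : n.+1.-tuple letter) : mon rx w = rx (thead w) * mon rx (behead w).
Proof. by case/tupleP: w => u w; rewrite theadE /= mon_cons. Qed.

Lemma rees_standard : standard_graded gr.
Proof.
split.
- exact: gr0.
- by move=> n c a b ha hb; apply: grD => //; apply: grZ.
- exact: grM.
- move=> a; have [s es] := spanned_all a; have [N hN] := homogeneous_parts s.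
  exists N, (fun i => \sum_(p <- s | size p.2 == i) p.1 *: mon rx p.2).
  by split=> [i|]; [apply: parts_gr | rewrite -hN].
- exact: gr_directP.
- move=> a; split=> [/rx_span[c [_ ->]]|[c ->]].
    exists (\sum_w c w); rewrite scaler_suml; apply: eq_bigr => w _.
    by rewrite tuple0 /mon big_nil.
  by have := @grZ 0 c _ (@word_gr [::]); rewrite /mon big_nil.
- exists (undup [seq rx u | u <- enum letter]); split=> [a|a ha].
    by rewrite mem_undup => /mapP[u _ ->]; apply: rx_gr.
  have [c [_ ->]] := rx_span ha.
  exists (fun z => \sum_(w : 1.-tuple letter | rx (thead w) == z) c w).
  under [RHS]eq_bigr do rewrite scaler_suml big_mkcond.
  rewrite exchange_big; apply: eq_bigr => w _ /=.
  rewrite -big_mkcond /= (big_rem (rx (thead w))) /=; last first.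
    by rewrite mem_undup map_f // mem_enum.
  rewrite eqxx big1_seq ?addr0 => [|z /andP[/eqP <-]].
    have /size0nil w0 : size (behead w) = 0%N by rewrite size_behead size_tuple.
    by rewrite mon_thead w0 /mon big_nil mulr1.
  by rewrite mem_rem_uniqF // undup_uniq.
move=> n a /rx_span[c [_ ->]].
exists [seq (c w *: rx (thead w), mon rx (behead w)) | w <- enum {: n.+1.-tuple letter}].
split=> [p /mapP[w _ ->]|] /=.
  split; first by apply: grZ; apply: rx_gr.
  by have := @word_gr (behead w); rewrite size_behead size_tuple.
rewrite big_map big_enum; apply: eq_bigr => w _ /=.
by rewrite mon_thead -scalerAl.
Qed.

Theorem staircase_Koszul : Koszul gr.
Proof.
apply: (quadratic_basis_Koszul rees_standard bad_sym _ rx_free rx_gr rx_span (wt := wt)).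
move=> z y; apply: rewrite_bad.
- exact: rE0.
- exact: rEN.
- exact: rE_plucker.
- exact: rE_va.
- exact: rE_vb.
- exact: rE_shift.
Qed.

End ReesRing.
End Staircase.

(** * Rational normal scrolls *)

Lemma sum_antisym (R : pzRingType) m (b f : 'I_m -> 'I_m -> R) :
  (forall p, f p p = 0) -> (forall p q, f q p = - f p q) ->
  \sum_(p < m) \sum_(q < m) b p q * f p q =
  \sum_(p < m) \sum_(q < m | (p < q)%N) (b p q - b q p) * f p q.
Proof.
move=> ff fN.
rewrite (eq_bigr (fun p : 'I_m => \sum_(q < m | (p < q)%N) b p q * f p q
    + \sum_(q < m | (q < p)%N) b p q * f p q)) => [|p _]; last first.
  rewrite (bigID (fun q : 'I_m => (p < q)%N)) /=; congr (_ + _).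
  rewrite (bigID (fun q : 'I_m => (q < p)%N)) /= [X in _ + X]big1 ?addr0 => [|q].
    by apply: eq_bigl => q; rewrite -leqNgt; case: ltngtP.
  by rewrite -!leqNgt -eqn_leq => /eqP/val_inj ->; rewrite ff mulr0.
rewrite big_split /= [X in _ + X](exchange_big_dep xpredT) //= -big_split /=.
apply: eq_bigr => p _; rewrite -big_split /=; apply: eq_bigr => q _.
by rewrite (fN p q) mulrN mulrBl.
Qed.

Section ScrollStaircase.
Variables (K : fieldType) (d : nat) (n : 'I_d -> nat).
Local Notation V := (scroll_var n).
Local Notation C := (scroll_col n).

Definition top_var (p : C) : V :=
  Tagged (fun i => 'I_(n i).+1) (inord (tagged p) : 'I_(n (tag p)).+1).
Definition bottom_var (p : C) : V :=
  Tagged (fun i => 'I_(n i).+1) (inord (tagged p).+1 : 'I_(n (tag p)).+1).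
Definition width := \max_i n i.
(** Blocks are compared by their size first: among last columns the order then
    agrees with the order of their predecessors, as [col_ord_mono] requires. *)
Definition slope (i : 'I_d) := (n i * d + i)%N.
Definition slope_bound := (width.+1 * d)%N.
(** The index of the column in its block, except that a last column is moved after
    all the columns that are not last. *)
Definition level i l := (if l.+1 == n i then width else l)%N.
(** Lexicographic order on the level and the slope, as a number. *)
Definition code i l := (level i l * slope_bound + slope i)%N.
Definition col_ord (p : C) := code (tag p) (tagged p).
Definition col_last (p : C) := (tagged p).+1 == n (tag p).
Definition var_height (v : V) := (\sum_(0 <= l < tagged v) code (tag v) l)%N.

Lemma slope_lt i : (slope i < slope_bound)%N.
Proof.
rewrite /slope /slope_bound mulSn addnC -addSn leq_add ?ltn_ord //.
by rewrite leq_mul2r leq_bigmax ?orbT.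
Qed.

Lemma slope_inj i j : slope i = slope j -> i = j.
Proof.
rewrite /slope => e; apply: val_inj => /=.
by have := congr1 (modn^~ d) e; rewrite !modnMDl !modn_small.
Qed.

Lemma code_lt i l j m : (code i l < code j m)%N =
  (level i l < level j m)%N || (level i l == level j m) && (slope i < slope j)%N.
Proof.
have hi := slope_lt i; have hj := slope_lt j; rewrite /code.
case: (ltngtP (level i l) (level j m)) => [h|h|->] /=; last by rewrite ltn_add2l.
  have := leq_mul2r slope_bound (level i l).+1 (level j m); rewrite h orbT mulSn.
  move: (_ * _)%N (_ * _)%N => a b; lia.
have := leq_mul2r slope_bound (level j m).+1 (level i l); rewrite h orbT mulSn.
move: (_ * _)%N (_ * _)%N => a b; lia.
Qed.

Lemma code_eq i l j m : code i l = code j m -> level i l = level j m /\ i = j.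
Proof.
move=> e; have := code_lt i l j m; have := code_lt j m i l; rewrite e ltnn => h1 h2.
have [el es] : level i l = level j m /\ slope i = slope j by move: h1 h2; clear; lia.
by split=> //; apply: slope_inj.
Qed.

Lemma n_width i : (n i <= width)%N.
Proof. exact: leq_bigmax. Qed.

Lemma var_eq (v w : V) : tag v = tag w -> tagged v = tagged w :> nat -> v = w.
Proof.
case: v w => [i l] [j m] /= e; case: j / e m => m /= e.
by congr existT; apply: val_inj.
Qed.

Lemma col_eq (p q : C) : tag p = tag q -> tagged p = tagged q :> nat -> p = q.
Proof.
case: p q => [i l] [j m] /= e; case: j / e m => m /= e.
by congr existT; apply: val_inj.
Qed.

Lemma tagged_top p : tagged (top_var p) = tagged p :> nat.
Proof. by rewrite /= inordK // ltnS ltnW. Qed.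

Lemma tagged_bottom p : tagged (bottom_var p) = (tagged p).+1 :> nat.
Proof. by rewrite /= inordK // ltnS. Qed.

Lemma top_bottom p q : top_var p = bottom_var q <->
  tag p = tag q /\ tagged p = (tagged q).+1 :> nat.
Proof.
split=> [e|[e1 e2]].
  by split; [exact: (congr1 tag e) | rewrite -tagged_top e tagged_bottom].
by apply: var_eq => //; rewrite tagged_top tagged_bottom.
Qed.

Lemma top_var_inj : injective top_var.
Proof.
move=> p q e; apply: col_eq; first exact: (congr1 tag e).
by rewrite -tagged_top e tagged_top.
Qed.

Lemma bottom_var_inj : injective bottom_var.
Proof.
move=> p q e; apply: col_eq; first exact: (congr1 tag e).
by apply: succn_inj; rewrite -!tagged_bottom e.
Qed.

Lemma level_last p : col_last p -> level (tag p) (tagged p) = width.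
Proof. by rewrite /level /col_last => ->. Qed.

Lemma level_not_last p : ~~ col_last p -> level (tag p) (tagged p) = tagged p.
Proof. by rewrite /level /col_last => /negPf ->. Qed.

Lemma not_last_width p : ~~ col_last p -> ((tagged p).+1 < width)%N.
Proof.
rewrite /col_last => nl; apply: leq_trans (n_width (tag p)).
by rewrite ltn_neqAle nl ltn_ord.
Qed.

Lemma col_ord_inj : injective col_ord.
Proof.
move=> p q /code_eq[el et]; apply: col_eq => //; move: el.
have [lp|np] := boolP (col_last p); have [lq|nq] := boolP (col_last q).
- by move=> _; have := congr1 n et; move: lp lq; rewrite /col_last => /eqP ep /eqP eq en; apply: succn_inj; rewrite ep eq.
- by rewrite (level_last lp) (level_not_last nq); have := not_last_width nq; lia.
- by rewrite (level_last lq) (level_not_last np); have := not_last_width np; lia.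
- by rewrite !level_not_last.
Qed.

Lemma col_ord_last p q : ~~ col_last p -> col_last q -> (col_ord p < col_ord q)%N.
Proof.
move=> np lq; rewrite /col_ord code_lt (level_last lq) (level_not_last np).
by have := not_last_width np; lia.
Qed.

Lemma col_lastP p : reflect (exists q, top_var q = bottom_var p) (~~ col_last p).
Proof.
apply: (iffP idP) => [nl|[q /top_bottom[et ev]]].
  have h : ((tagged p).+1 < n (tag p))%N by rewrite ltn_neqAle [_ == _](negPf nl) ltn_ord.
  exists (Tagged (fun i => 'I_(n i)) (Ordinal h) : C).
  by apply/top_bottom.
by rewrite /col_last -ev -et neq_ltn ltn_ord.
Qed.

Lemma step_levels k p : bottom_var k = top_var p ->
  [/\ tag k = tag p, level (tag k) (tagged k) = tagged k & tagged p = (tagged k).+1 :> nat].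
Proof.
move=> e; have /top_bottom[et ev] := esym e; split=> //.
by apply: level_not_last; apply/col_lastP; exists p.
Qed.

Lemma col_ord_step k p : bottom_var k = top_var p -> (col_ord k < col_ord p)%N.
Proof.
case/step_levels => et ek ev; rewrite /col_ord code_lt ek.
have [lp|np] := boolP (col_last p).
  by rewrite (level_last lp); have := ltn_ord (tagged p); have := n_width (tag p); lia.
by rewrite (level_not_last np) ev ltnSn.
Qed.

Lemma slope_n i j : (n i < n j)%N -> (slope i < slope j)%N.
Proof.
move=> h; rewrite /slope; apply: (@leq_trans ((n i).+1 * d)%N).
  by rewrite mulSn addnC ltn_add2r.
by apply: leq_trans (leq_addr _ _); rewrite leq_mul2r h orbT.
Qed.

Lemma col_ord_mono p q k : col_last p = col_last q -> bottom_var k = top_var q ->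
  (forall k', bottom_var k' = top_var p -> (col_ord k' < col_ord k)%N) ->
  (col_ord p < col_ord q)%N.
Proof.
move=> lpq /step_levels[ekt ek ekv] hk.
have h : (tagged p < tagged q)%N ||
    (tagged p == tagged q :> nat) && (slope (tag p) < slope (tag q))%N.
  case ep : (tagged p : nat) => [|l]; first by rewrite ekv.
  have hl : (l < n (tag p))%N by have := ltn_ord (tagged p); lia.
  pose k' : C := Tagged (fun i => 'I_(n i)) (Ordinal hl).
  have e' : bottom_var k' = top_var p by apply/esym/top_bottom.
  have [_ ek' _] := step_levels e'.
  have := hk _ e'; rewrite /col_ord code_lt ek ek' (congr1 slope ekt) /= ekv.
  by rewrite ltnS eqSS.
rewrite /col_ord code_lt; move: lpq.
have [lq|nq] := boolP (col_last q) => lp; last first.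
  by rewrite !level_not_last ?lp.
rewrite !level_last ?lp // ltnn eqxx /=.
case/orP: h => [h|/andP[_ //]]; apply: slope_n.
by move: lp lq; rewrite /col_last => /eqP ep /eqP eq; rewrite -[ltnLHS]ep -[ltnRHS]eq ltnS.
Qed.

Lemma var_height_step p :
  var_height (bottom_var p) = (var_height (top_var p) + col_ord p)%N.
Proof.
by rewrite /var_height tagged_top tagged_bottom big_nat_recr.
Qed.

Lemma var_height_first v : (forall k, bottom_var k <> v) -> var_height v = 0%N.
Proof.
move=> h; rewrite /var_height; case ev : (tagged v : nat) => [|l]; first by rewrite big_geq.
have hl : (l < n (tag v))%N by have := ltn_ord (tagged v); rewrite ev ltnS.
case: (h (Tagged (fun i => 'I_(n i)) (Ordinal hl))).
by apply: var_eq => //; rewrite tagged_bottom ev.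
Qed.

Lemma scroll_minorE (p q : 'I_#|{: C}|) :
  scroll_minor K p q = cross K top_var bottom_var (enum_val p) (enum_val q).
Proof.
rewrite /scroll_minor /cross !mxE /xv /scroll_x /top_var /bottom_var /=.
by rewrite !addn0 !addn1.
Qed.

Lemma scroll_ideal_cross (r : {mpoly K[#|{: V}|]}) : @scroll_ideal K d n r <->
  exists a : C -> C -> {mpoly K[#|{: V}|]},
    r = \sum_p \sum_q a p q * cross K top_var bottom_var p q.
Proof.
pose f (p q : 'I_#|{: C}|) : {mpoly K[#|{: V}|]} := scroll_minor K p q.
have ff p : f p p = 0 by rewrite /f /scroll_minor subrr.
have fN p q : f q p = - f p q by rewrite /f /scroll_minor opprB.
have reidx (F : C -> C -> {mpoly K[#|{: V}|]}) : \sum_p \sum_q F p q =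
    \sum_(p < #|{: C}|) \sum_(q < #|{: C}|) F (enum_val p) (enum_val q).
  rewrite (reindex_onto enum_val enum_rank) => [|p _]; last exact: enum_rankK.
  rewrite (eq_bigl xpredT) => [|p]; last by rewrite /= enum_valK eqxx.
  apply: eq_bigr => p _; rewrite (reindex_onto enum_val enum_rank) => [|q _]; last exact: enum_rankK.
  by apply: eq_bigl => q; rewrite /= enum_valK eqxx.
split=> [[a ->]|[a ->]].
  exists (fun p q => if (enum_rank p < enum_rank q)%N then a (enum_rank p) (enum_rank q) else 0).
  rewrite reidx; apply: eq_bigr => p _; rewrite big_mkcond; apply: eq_bigr => q _.
  by rewrite !enum_valK -scroll_minorE; case: ifP => // _; rewrite mul0r.
pose b (p q : 'I_#|{: C}|) := a (enum_val p) (enum_val q).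
exists (fun p q => b p q - b q p).
rewrite reidx -(sum_antisym b ff fN).
by apply: eq_bigr => p _; apply: eq_bigr => q _; rewrite /f scroll_minorE.
Qed.

Theorem scroll_Koszul : Koszul (@rees_gr K #|{: V}| (@scroll_ideal K d n)).
Proof.
exact: (staircase_Koszul top_var_inj bottom_var_inj col_ord_inj col_ord_last col_ord_step
  col_lastP col_ord_mono var_height_step var_height_first scroll_ideal_cross).
Qed.

End ScrollStaircase.

Theorem corollary4p11 (K : fieldType) (d : nat) (n : 'I_d -> nat)
  (hd : (0 < d)%N) (hn : forall i : 'I_d, (0 < n i)%N) :
  Koszul (@rees_gr K #|{: scroll_var n}| (@scroll_ideal K d n)).
Proof. exact: scroll_Koszul. Qed.
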